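(* Ultimately periodic model checking and ultimately constant model checking of $\mathrm{LTL}(\sim)$ are logspace-reducible to $\mathbf{\Delta^2_0}$.
   Context: Let $\mathrm{AP}$ be a countably infinite set of atomic propositions. A trace is an infinite sequence $t=t(0)t(1)\cdots\in(\wp\mathrm{AP})^\omega$, and $t^i=t(i)t(i+1)\cdots$. A team is a (possibly empty) set $T$ of traces, and $T^i=\{t^i: t\in T\}$. Formulas of $\mathrm{LTL}(\sim)$ are given by $\varphi::=p\mid\neg\varphi\mid\varphi\wedge\varphi\mid\varphi\vee\varphi\mid\mathsf X\varphi\mid\mathsf F\varphi\mid\mathsf G\varphi\mid\varphi\,\mathsf U\,\varphi\mid\varphi\,\mathsf R\,\varphi\mid{\sim}\varphi$ with $p\in\mathrm{AP}$. Synchronous team semantics: $T\models p$ iff $p\in t(0)$ for all $t\in T$; $T\models\neg\varphi$ iff $\{t\}\not\models\varphi$ for all $t\in T$; $T\models\varphi\wedge\psi$ iff $T\models\varphi$ and $T\models\psi$; $T\models\varphi\vee\psi$ iff $T=S\cup U$ for some $S,U$ with $S\models\varphi$ and $U\models\psi$; $T\models\mathsf X\varphi$ iff $T^1\models\varphi$; $T\models\mathsf F\varphi$ iff $T^k\models\varphi$ for some $k\ge0$; $T\models\mathsf G\varphi$ iff $T^k\models\varphi$ for all $k\ge0$; $T\models\varphi\,\mathsf U\,\psi$ iff there is $k\ge0$ with $T^k\models\psi$ and $T^j\models\varphi$ for all $j<k$; $T\models\varphi\,\mathsf R\,\psi$ iff for all $k\ge0$, $T^k\models\psi$ or $T^j\models\varphi$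 for some $j<k$; $T\models{\sim}\varphi$ iff $T\not\models\varphi$. A finite Kripke structure is $K=(W,R,\eta,r)$ with $W$ finite nonempty, $R\subseteq W\times W$ serial, $\eta:W\to\wp\mathrm{AP}$ with finite labels, and root $r\in W$; a path is $\pi\in W^\omega$ with $\pi(0)=r$ and $(\pi(i),\pi(i+1))\in R$; it induces the trace $(\eta(\pi(i)))_{i\ge0}$; $T(K)$ is the team of all induced traces. A trace $t$ is ultimately periodic if there are $c,d>0$ with $t(n)=t(n+d)$ for all $n\ge c$, and ultimately constant if some suffix $t^i$ is constant. Ultimately periodic (resp. constant) model checking: the set of pairs $(K,\varphi)$, $K$ a finite Kripke structure, such that $T(K)\cap\mathcal C\models\varphi$, where $\mathcal C$ is the class of ultimately periodic (resp. ultimately constant) traces. $\mathbf{\Delta^2_0}$ denotes the set of closed formulas of second-order arithmetic (vocabulary $+,\times,0,1,=,\le$; first-order variables over $\mathbb N$, second-order variables of arity $n$ over subsets of $\mathbb N^n$) true in the standard model $\mathbb N$. *)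

(* Defs.v *)
From Stdlib Require Import Bool List Arith NArith PArith.
Import ListNotations.
Open Scope bool_scope.

(* AP = nat (countably infinite). A trace t : nat -> wp(AP), given as
   t i p = true iff p is in t(i). *)
Definition trace := nat -> nat -> bool.
Definition team := trace -> Prop.

Definition tsuffix (t : trace) (k : nat) : trace := fun i p => t (i + k) p.

Definition team_suffix (T : team) (k : nat) : team :=
  fun u => exists t, T t /\ forall i p, u i p = tsuffix t k i p.

Definition singleton (t : trace) : team :=
  fun u => forall i p, u i p = t i p.

Inductive ltl : Type :=
| LAtom (p : nat)
| LNeg (a : ltl)
| LAnd (a b : ltl)
| LOr (a b : ltl)
| LX (a : ltl)
| LF (a : ltl)
| LG (a : ltl)
| LU (a b : ltl)
| LR (a b : ltl)
| LTilde (a : ltl).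

Fixpoint tsat (T : team) (f : ltl) {struct f} : Prop :=
  match f with
  | LAtom p => forall t, T t -> t 0 p = true
  | LNeg a => forall t, T t -> ~ tsat (singleton t) a
  | LAnd a b => tsat T a /\ tsat T b
  | LOr a b => exists S U : team, (forall t, T t <-> S t \/ U t)
                                  /\ tsat S a /\ tsat U b
  | LX a => tsat (team_suffix T 1) a
  | LF a => exists k, tsat (team_suffix T k) a
  | LG a => forall k, tsat (team_suffix T k) a
  | LU a b => exists k, tsat (team_suffix T k) b /\
                        forall j, j < k -> tsat (team_suffix T j) a
  | LR a b => forall k, tsat (team_suffix T k) b \/
                        exists j, j < k /\ tsat (team_suffix T j) a
  | LTilde a => ~ tsat T a
  end.

(* Worlds are 0, ..., kw_n - 1; the label of world w is the finite set
   nth w kw_lab []. *)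
Record kripke := {
  kw_n : nat;
  kw_edges : list (nat * nat);
  kw_lab : list (list nat);
  kw_root : nat }.

Definition kripke_wf (K : kripke) : Prop :=
  0 < kw_n K /\ kw_root K < kw_n K /\ length (kw_lab K) = kw_n K /\
  (forall v w, In (v, w) (kw_edges K) -> v < kw_n K /\ w < kw_n K) /\
  (forall v, v < kw_n K -> exists w, In (v, w) (kw_edges K)).

Definition is_path (K : kripke) (pi : nat -> nat) : Prop :=
  pi 0 = kw_root K /\ forall i, In (pi i, pi (S i)) (kw_edges K).

Definition label (K : kripke) (w : nat) (p : nat) : bool :=
  existsb (Nat.eqb p) (nth w (kw_lab K) []).

Definition teamK (K : kripke) : team :=
  fun t => exists pi, is_path K pi /\ forall i p, t i p = label K (pi i) p.

Definition ult_periodic (t : trace) : Prop :=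
  exists c d, 0 < c /\ 0 < d /\ forall n p, c <= n -> t n p = t (n + d) p.

Definition ult_constant (t : trace) : Prop :=
  exists i, forall n p, t (i + n) p = t i p.

Definition team_inter (T C : team) : team := fun t => T t /\ C t.

Inductive aterm : Type :=
| AVar (i : nat) | AZero | AOne | APlus (a b : aterm) | ATimes (a b : aterm).

(* second-order variables are pairs (name X, arity = length of args) *)
Inductive soa : Type :=
| SEq (a b : aterm)
| SLe (a b : aterm)
| SApp (X : nat) (ts : list aterm)
| SNot (f : soa)
| SAnd (f g : soa)
| SOr (f g : soa)
| SEx1 (i : nat) (f : soa)
| SAll1 (i : nat) (f : soa)
| SEx2 (X n : nat) (f : soa)
| SAll2 (X n : nat) (f : soa).

Fixpoint aeval (e : nat -> nat) (t : aterm) : nat :=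
  match t with
  | AVar i => e i | AZero => 0 | AOne => 1
  | APlus a b => aeval e a + aeval e b
  | ATimes a b => aeval e a * aeval e b
  end.

Definition upd1 (e : nat -> nat) (i v : nat) : nat -> nat :=
  fun j => if Nat.eqb j i then v else e j.

(* a relation of arity n is a predicate on lists (consulted only on lists
   of length n), i.e. a subset of N^n *)
Definition env2 := nat -> nat -> list nat -> Prop.

Definition upd2 (e : env2) (X n : nat) (S : list nat -> Prop) : env2 :=
  fun Y m => if Nat.eqb Y X && Nat.eqb m n then S else e Y m.

Fixpoint ssat (e1 : nat -> nat) (e2 : env2) (f : soa) : Prop :=
  match f with
  | SEq a b => aeval e1 a = aeval e1 b
  | SLe a b => aeval e1 a <= aeval e1 b
  | SApp X ts => e2 X (length ts) (map (aeval e1) ts)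
  | SNot g => ~ ssat e1 e2 g
  | SAnd g h => ssat e1 e2 g /\ ssat e1 e2 h
  | SOr g h => ssat e1 e2 g \/ ssat e1 e2 h
  | SEx1 i g => exists v, ssat (upd1 e1 i v) e2 g
  | SAll1 i g => forall v, ssat (upd1 e1 i v) e2 g
  | SEx2 X n g => exists S : list nat -> Prop, ssat e1 (upd2 e2 X n S) g
  | SAll2 X n g => forall S : list nat -> Prop, ssat e1 (upd2 e2 X n S) g
  end.

Fixpoint aclosed (b : list nat) (t : aterm) : bool :=
  match t with
  | AVar i => existsb (Nat.eqb i) b
  | AZero | AOne => true
  | APlus a c | ATimes a c => aclosed b a && aclosed b c
  end.

Fixpoint sclosed (b1 : list nat) (b2 : list (nat * nat)) (f : soa) : bool :=
  match f with
  | SEq a c | SLe a c => aclosed b1 a && aclosed b1 c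
  | SApp X ts =>
      existsb (fun '(Y, m) => Nat.eqb X Y && Nat.eqb (length ts) m) b2
      && forallb (aclosed b1) ts
  | SNot g => sclosed b1 b2 g
  | SAnd g h | SOr g h => sclosed b1 b2 g && sclosed b1 b2 h
  | SEx1 i g | SAll1 i g => sclosed (i :: b1) b2 g
  | SEx2 X n g | SAll2 X n g => sclosed b1 ((X, n) :: b2) g
  end.

Definition closed_soa (f : soa) : Prop := sclosed [] [] f = true.

(* truth in the standard model (environments irrelevant for closed f) *)
Definition soa_true (f : soa) : Prop :=
  ssat (fun _ => 0) (fun _ _ _ => False) f.

Inductive tok : Type := D0 | D1 | Comma | LPar | RPar.

Fixpoint bin_pos (p : positive) : list tok :=
  match p with
  | xH => [D1]
  | xO q => bin_pos q ++ [D0]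
  | xI q => bin_pos q ++ [D1]
  end.

Definition enc_nat (n : nat) : list tok :=
  match N.of_nat n with N0 => [D0] | Npos p => bin_pos p end.

Definition node (k : nat) (cs : list (list tok)) : list tok :=
  LPar :: enc_nat k ++ flat_map (fun c => Comma :: c) cs ++ [RPar].

Definition enc_list (cs : list (list tok)) : list tok := node 0 cs.

Fixpoint enc_ltl (f : ltl) : list tok :=
  match f with
  | LAtom p => node 0 [enc_nat p]
  | LNeg a => node 1 [enc_ltl a]
  | LAnd a b => node 2 [enc_ltl a; enc_ltl b]
  | LOr a b => node 3 [enc_ltl a; enc_ltl b]
  | LX a => node 4 [enc_ltl a]
  | LF a => node 5 [enc_ltl a]
  | LG a => node 6 [enc_ltl a]
  | LU a b => node 7 [enc_ltl a; enc_ltl b]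
  | LR a b => node 8 [enc_ltl a; enc_ltl b]
  | LTilde a => node 9 [enc_ltl a]
  end.

Definition enc_kripke (K : kripke) : list tok :=
  node 0 [enc_nat (kw_n K);
          enc_list (map (fun '(v, w) => node 0 [enc_nat v; enc_nat w]) (kw_edges K));
          enc_list (map (fun l => enc_list (map enc_nat l)) (kw_lab K));
          enc_nat (kw_root K)].

Definition enc_instance (K : kripke) (f : ltl) : list tok :=
  node 0 [enc_kripke K; enc_ltl f].

Fixpoint enc_aterm (t : aterm) : list tok :=
  match t with
  | AVar i => node 0 [enc_nat i]
  | AZero => node 1 []
  | AOne => node 2 []
  | APlus a b => node 3 [enc_aterm a; enc_aterm b]
  | ATimes a b => node 4 [enc_aterm a; enc_aterm b]
  end.

Fixpoint enc_soa (f : soa) : list tok :=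
  match f with
  | SEq a b => node 0 [enc_aterm a; enc_aterm b]
  | SLe a b => node 1 [enc_aterm a; enc_aterm b]
  | SApp X ts => node 2 [enc_nat X; enc_list (map enc_aterm ts)]
  | SNot g => node 3 [enc_soa g]
  | SAnd g h => node 4 [enc_soa g; enc_soa h]
  | SOr g h => node 5 [enc_soa g; enc_soa h]
  | SEx1 i g => node 6 [enc_nat i; enc_soa g]
  | SAll1 i g => node 7 [enc_nat i; enc_soa g]
  | SEx2 X n g => node 8 [enc_nat X; enc_nat n; enc_soa g]
  | SAll2 X n g => node 9 [enc_nat X; enc_nat n; enc_soa g]
  end.

Definition MC_lang (C : trace -> Prop) (w : list tok) : Prop :=
  exists K f, w = enc_instance K f /\ kripke_wf K /\
              tsat (team_inter (teamK K) C) f.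

Definition Delta20 (w : list tok) : Prop :=
  exists f, w = enc_soa f /\ closed_soa f /\ soa_true f.

(* Logspace transducers: deterministic TM with a read-only input tape  *)
(* (with end markers), one work tape, and a write-only output tape.    *)

Inductive move : Type := MLeft | MStay | MRight.
Inductive cell : Type := LEnd | Sym (a : tok) | REnd.

(* states are 0..tm_nst-1; work symbols are 0..tm_nwk-1, 0 = blank *)
Record TM := {
  tm_nst : nat;
  tm_nwk : nat;
  tm_start : nat;
  tm_halt : nat;
  tm_delta : nat -> cell -> nat -> nat * move * nat * move * option tok }.

Definition tm_wf (M : TM) : Prop :=
  tm_start M < tm_nst M /\ tm_halt M < tm_nst M /\ 0 < tm_nwk M /\
  forall q c s, q < tm_nst M -> s < tm_nwk M ->
    let '(q', _, s', _, _) := tm_delta M q c s in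
    q' < tm_nst M /\ s' < tm_nwk M.

Record config := {
  c_st : nat; c_ih : nat; c_wt : list nat; c_wh : nat; c_out : list tok }.

Definition read_in (w : list tok) (h : nat) : cell :=
  match h with
  | 0 => LEnd
  | S h' => match nth_error w h' with Some a => Sym a | None => REnd end
  end.

Definition mv_in (w : list tok) (h : nat) (m : move) : nat :=
  match m with
  | MLeft => h - 1
  | MStay => h
  | MRight => Nat.min (S h) (S (length w))
  end.

Definition mv_wk (j : nat) (m : move) : nat :=
  match m with MLeft => j - 1 | MStay => j | MRight => S j end.

Fixpoint set_cell (l : list nat) (j s : nat) : list nat :=
  match j, l with
  | 0, [] => [s]
  | 0, _ :: r => s :: r
  | S j', [] => 0 :: set_cell [] j' s
  | S j', x :: r => x :: set_cell r j' s
  end.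

Definition tm_step (M : TM) (w : list tok) (c : config) : config :=
  if Nat.eqb (c_st c) (tm_halt M) then c else
  let '(q', mi, s', mw, o) :=
      tm_delta M (c_st c) (read_in w (c_ih c)) (nth (c_wh c) (c_wt c) 0) in
  {| c_st := q';
     c_ih := mv_in w (c_ih c) mi;
     c_wt := set_cell (c_wt c) (c_wh c) s';
     c_wh := mv_wk (c_wh c) mw;
     c_out := c_out c ++ match o with Some a => [a] | None => [] end |}.

Definition tm_init (M : TM) : config :=
  {| c_st := tm_start M; c_ih := 0; c_wt := []; c_wh := 0; c_out := [] |}.

Fixpoint tm_run (M : TM) (w : list tok) (k : nat) : config :=
  match k with
  | 0 => tm_init M
  | S k' => tm_step M w (tm_run M w k')
  end.

Definition logspace_computable (f : list tok -> list tok) : Prop :=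
  exists (M : TM) (c : nat), tm_wf M /\
    forall w, exists n,
      c_st (tm_run M w n) = tm_halt M /\
      c_out (tm_run M w n) = f w /\
      forall k, k <= n -> c_wh (tm_run M w k) <= c * Nat.log2 (length w) + c.

Definition logspace_reducible (A B : list tok -> Prop) : Prop :=
  exists f, logspace_computable f /\ forall w, A w <-> B (f w).

(* Main.v *)
(** An instance word [w] is mapped to the formula saying that there is a number [x]
    equal to the Horner code of [w], a ternary relation [E] and a set [X] such that
    [x] codes a well-formed instance whose team is enumerated by [E] on [X], and such
    that the translation of the LTL formula holds. The first conjunct is a fixed
    formula: the grammar of instances is a least fixed point, hence definable, and
    the team is countable, so it has an enumeration. It also rejects malformed words,
    so the transducer may output anything after it. In the translation a team is
    given by a set of indices into [E] and a time, so that suffixes change only the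
    time, and splittings are splittings of the set of indices. All LTL connectives
    share the same separators and closing parentheses, so that the translation is
    computed by a two-way finite transducer, without any work space. *)

Require Import Defs.
From Stdlib Require Import Bool List Arith NArith PArith Lia.
From Stdlib Require Import Classical ClassicalEpsilon FunctionalExtensionality.
Import ListNotations.

(** A finite control can neither match nested parentheses nor compare the number of labels with the
    number of worlds. The whole word is therefore handed over as one closed term, and the formula
    does the checking. Horner's scheme suits this: one group of tokens is opened per letter, and the
    groups are closed on the way back, without counting.

    On the LTL side the obstacle is that a binary connective evaluates its operands on different
    teams or at different times, while each operand can be written only once and in input order.
    Hence the frames of a connective quantify over the sides first, and both operands follow in a
    guarded conjunction: [is_right] or left, and not [is_right] or right. The frames rebind a fixed
    stock of variables, so no fresh names depend on the nesting.

    Two bounds make a finite control sufficient: the encoding of a structure is nested at most three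
    deep, and the node indices of LTL formulas are at most nine, hence fit into four bits. *)

Definition is_digit (a : tok) : bool :=
  match a with D0 | D1 => true | _ => false end.

Definition digit_val (a : tok) : nat := match a with D1 => 1 | _ => 0 end.

Definition digits_val (ds : list tok) : nat :=
  fold_left (fun v d => 2 * v + digit_val d) ds 0.

Lemma digits_val_snoc ds d :
  digits_val (ds ++ [d]) = 2 * digits_val ds + digit_val d.
Proof. unfold digits_val. now rewrite fold_left_app. Qed.

Lemma bin_pos_digits p : forallb is_digit (bin_pos p) = true.
Proof.
  induction p; cbn [bin_pos]; rewrite ?forallb_app, ?IHp; reflexivity.
Qed.

Lemma enc_nat_digits n : forallb is_digit (enc_nat n) = true.
Proof.
  unfold enc_nat. destruct (N.of_nat n); [reflexivity | apply bin_pos_digits].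
Qed.

Lemma bin_pos_val p : digits_val (bin_pos p) = Pos.to_nat p.
Proof.
  induction p; cbn [bin_pos]; rewrite ?digits_val_snoc, ?IHp;
    cbn [digit_val]; [| | reflexivity]; lia.
Qed.

Lemma enc_nat_val n : digits_val (enc_nat n) = n.
Proof.
  unfold enc_nat. destruct (N.of_nat n) eqn:H.
  - unfold digits_val; cbn; lia.
  - rewrite bin_pos_val. lia.
Qed.

Lemma bin_pos_cons p : exists a u, bin_pos p = a :: u /\ is_digit a = true.
Proof.
  induction p as [p (a & u & H & D) | p (a & u & H & D) |]; cbn [bin_pos].
  - rewrite H. exists a, (u ++ [D1]). auto.
  - rewrite H. exists a, (u ++ [D0]). auto.
  - exists D1, []. auto.
Qed.

Lemma enc_nat_cons n : exists a u, enc_nat n = a :: u /\ is_digit a = true.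
Proof.
  unfold enc_nat. destruct (N.of_nat n); [exists D0, []; auto | apply bin_pos_cons].
Qed.

Lemma enc_nat_double n : enc_nat (2 * S n) = enc_nat (S n) ++ [D0].
Proof.
  unfold enc_nat.
  replace (N.of_nat (2 * S n)) with (N.double (N.of_nat (S n))) by lia.
  now destruct (N.of_nat (S n)) eqn:H; [lia |].
Qed.

Lemma enc_nat_succ_double n : enc_nat (2 * S n + 1) = enc_nat (S n) ++ [D1].
Proof.
  unfold enc_nat.
  replace (N.of_nat (2 * S n + 1)) with (N.succ_double (N.of_nat (S n))) by lia.
  now destruct (N.of_nat (S n)) eqn:H; [lia |].
Qed.

(** * Words as numbers *)

(** No letter has the code zero, so that in base 6 the tail 0 marks the end of a word and words of
    different lengths get different codes. *)
Definition tok_code (a : tok) : nat :=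
  match a with D0 => 1 | D1 => 2 | Comma => 3 | LPar => 4 | RPar => 5 end.

(* The tail [y] need not be the code of a word: this lets a grammar be stated
   by relations between two numbers, the input before and after parsing. *)
Definition code (w : list tok) (y : nat) : nat :=
  fold_right (fun a z => tok_code a + 6 * z) y w.

Lemma code_app u v y : code (u ++ v) y = code u (code v y).
Proof. unfold code. now rewrite fold_right_app. Qed.

Lemma code_cons_inj a b x y :
  tok_code a + 6 * x = tok_code b + 6 * y -> a = b /\ x = y.
Proof. destruct a, b; cbn [tok_code]; intros H; split; solve [reflexivity | lia]. Qed.

Lemma code_heads_inj a b u v x y :
  code (a :: u) x = code (b :: v) y -> a = b /\ code u x = code v y.
Proof. apply code_cons_inj. Qed.

Lemma code_inj u v : code u 0 = code v 0 -> u = v.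
Proof.
  revert v; induction u as [| a u IH]; intros [| b v]; cbn [code fold_right]; intros H.
  - reflexivity.
  - destruct b; cbn [tok_code] in H; lia.
  - destruct a; cbn [tok_code] in H; lia.
  - apply code_cons_inj in H as [-> H]. f_equal. now apply IH.
Qed.

(** Binary numerals are not self-delimiting: a number can be split off uniquely only if the rest
    does not continue with a digit. The rest may be any number, hence a condition on numbers rather
    than on words. *)
Definition no_digit (x : nat) : Prop :=
  forall a z, is_digit a = true -> x <> tok_code a + 6 * z.

Lemma no_digit_code a w y : is_digit a = false -> no_digit (code (a :: w) y).
Proof.
  intros Ha b z Hb H. apply code_cons_inj in H as [-> _]. congruence.
Qed.

Lemma no_digit_0 : no_digit 0.
Proof. intros [] z _; cbn [tok_code]; lia. Qed.

Lemma digits_code_inj u v x y :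
  forallb is_digit u = true -> forallb is_digit v = true ->
  no_digit x -> no_digit y -> code u x = code v y -> u = v /\ x = y.
Proof.
  revert v; induction u as [| a u IH]; intros [| b v]; cbn [forallb]; intros Hu Hv Hx Hy H.
  - auto.
  - apply andb_prop in Hv as [Hb _]. now destruct (Hx b (code v y) Hb).
  - apply andb_prop in Hu as [Ha _]. now destruct (Hy a (code u x) Ha).
  - apply andb_prop in Hu as [_ Hu]. apply andb_prop in Hv as [_ Hv].
    apply code_cons_inj in H as [-> H].
    destruct (IH v Hu Hv Hx Hy H). now subst.
Qed.

Lemma enc_nat_code_inj m n x y :
  no_digit x -> no_digit y -> code (enc_nat m) x = code (enc_nat n) y ->
  m = n /\ x = y.
Proof.
  intros Hx Hy H.
  apply digits_code_inj in H as [H ->]; auto using enc_nat_digits.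
  rewrite <- (enc_nat_val m), <- (enc_nat_val n), H. auto.
Qed.

(** * Unique readability *)

(** One type of trees underlies all encodings, so that unique readability is proved once for terms,
    formulas, structures and instances. *)
Inductive tree : Type :=
| Leaf (n : nat)
| Node (k : nat) (cs : list tree).

Fixpoint enc_tree (t : tree) : list tok :=
  match t with
  | Leaf n => enc_nat n
  | Node k cs => node k (map enc_tree cs)
  end.

Definition forest (cs : list tree) : list tok :=
  flat_map (fun t => Comma :: enc_tree t) cs.

Lemma forest_cons t cs : forest (t :: cs) = Comma :: enc_tree t ++ forest cs.
Proof. reflexivity. Qed.

Lemma flat_map_commas {A} (g : A -> list tok) (l : list A) :
  flat_map (fun c => Comma :: c) (map g l) = flat_map (fun x => Comma :: g x) l.
Proof. induction l; cbn; congruence. Qed.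

Lemma enc_tree_node k cs :
  enc_tree (Node k cs) = LPar :: enc_nat k ++ forest cs ++ [RPar].
Proof. cbn [enc_tree]. unfold node. now rewrite flat_map_commas. Qed.

Lemma enc_list_forest {A} (g : A -> tree) (l : list A) :
  enc_list (map (fun x => enc_tree (g x)) l) = enc_tree (Node 0 (map g l)).
Proof. unfold enc_list. cbn [enc_tree]. now rewrite map_map. Qed.

Lemma tree_ind_forall (P : tree -> Prop) :
  (forall n, P (Leaf n)) -> (forall k cs, Forall P cs -> P (Node k cs)) ->
  forall t, P t.
Proof.
  intros HL HN. fix IH 1. intros [n | k cs]; [apply HL | apply HN].
  induction cs; constructor; auto.
Qed.

(** The tails belong to the statement because a subtree is read with its siblings still to come. *)
Definition readable (s : tree) : Prop :=
  forall t x y, no_digit x -> no_digit y ->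
    code (enc_tree s) x = code (enc_tree t) y -> s = t /\ x = y.

Lemma no_digit_forest cs x : no_digit (code (forest cs) (code [RPar] x)).
Proof. destruct cs; now apply no_digit_code. Qed.

(** The next letter tells whether another child follows ([Comma]) or the list ends ([RPar]). Neither
    is a digit, so the delimiting condition holds after each child. *)
Lemma forest_code_inj_aux cs cs' x y :
  Forall readable cs ->
  code (forest cs) (code [RPar] x) = code (forest cs') (code [RPar] y) ->
  cs = cs' /\ x = y.
Proof.
  intros F; revert cs'; induction F as [| t cs Ht F IH]; intros [| t' cs'] H.
  - now apply code_heads_inj in H.
  - now apply code_heads_inj in H.
  - now apply code_heads_inj in H.
  - rewrite !forest_cons in H. apply code_heads_inj in H as [_ H].
    rewrite !code_app in H.
    apply Ht in H as [-> H]; auto using no_digit_forest.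
    apply IH in H as [-> ->]. auto.
Qed.

Lemma enc_tree_readable s : readable s.
Proof.
  induction s as [n | k cs IH] using tree_ind_forall; intros [m | k' cs'] x y Hx Hy H.
  - apply enc_nat_code_inj in H as [-> ->]; auto.
  - destruct (enc_nat_cons n) as (a & u & E & D). cbn [enc_tree] in H.
    rewrite E in H. apply code_heads_inj in H as [-> _]. discriminate.
  - destruct (enc_nat_cons m) as (a & u & E & D). cbn [enc_tree] in H.
    rewrite E in H. apply code_heads_inj in H as [<- _]. discriminate.
  - rewrite !enc_tree_node in H. apply code_heads_inj in H as [_ H].
    rewrite !code_app in H.
    apply enc_nat_code_inj in H as [-> H]; auto using no_digit_forest.
    apply forest_code_inj_aux in H as [-> ->]; auto.
Qed.

Lemma forest_code_inj cs cs' x y :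
  code (forest cs) (code [RPar] x) = code (forest cs') (code [RPar] y) ->
  cs = cs' /\ x = y.
Proof.
  apply forest_code_inj_aux, Forall_forall. intros t _. apply enc_tree_readable.
Qed.

Lemma map_inj {A B} (g : A -> B) :
  (forall x y, g x = g y -> x = y) -> forall l l', map g l = map g l' -> l = l'.
Proof.
  intros Hg; induction l as [| x l IH]; intros [| y l'] H; try discriminate; auto.
  injection H as H1 H2. f_equal; auto.
Qed.

(** * Syntax trees of terms, formulas and structures *)

Fixpoint aterm_tree (t : aterm) : tree :=
  match t with
  | AVar i => Node 0 [Leaf i]
  | AZero => Node 1 []
  | AOne => Node 2 []
  | APlus a b => Node 3 [aterm_tree a; aterm_tree b]
  | ATimes a b => Node 4 [aterm_tree a; aterm_tree b]
  end.

Fixpoint soa_tree (f : soa) : tree :=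
  match f with
  | SEq a b => Node 0 [aterm_tree a; aterm_tree b]
  | SLe a b => Node 1 [aterm_tree a; aterm_tree b]
  | SApp X ts => Node 2 [Leaf X; Node 0 (map aterm_tree ts)]
  | SNot g => Node 3 [soa_tree g]
  | SAnd g h => Node 4 [soa_tree g; soa_tree h]
  | SOr g h => Node 5 [soa_tree g; soa_tree h]
  | SEx1 i g => Node 6 [Leaf i; soa_tree g]
  | SAll1 i g => Node 7 [Leaf i; soa_tree g]
  | SEx2 X n g => Node 8 [Leaf X; Leaf n; soa_tree g]
  | SAll2 X n g => Node 9 [Leaf X; Leaf n; soa_tree g]
  end.

Fixpoint ltl_tree (f : ltl) : tree :=
  match f with
  | LAtom p => Node 0 [Leaf p]
  | LNeg a => Node 1 [ltl_tree a]
  | LAnd a b => Node 2 [ltl_tree a; ltl_tree b]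
  | LOr a b => Node 3 [ltl_tree a; ltl_tree b]
  | LX a => Node 4 [ltl_tree a]
  | LF a => Node 5 [ltl_tree a]
  | LG a => Node 6 [ltl_tree a]
  | LU a b => Node 7 [ltl_tree a; ltl_tree b]
  | LR a b => Node 8 [ltl_tree a; ltl_tree b]
  | LTilde a => Node 9 [ltl_tree a]
  end.

Definition edge_tree (e : nat * nat) : tree := Node 0 [Leaf (fst e); Leaf (snd e)].

Definition label_tree (l : list nat) : tree := Node 0 (map Leaf l).

Definition kripke_tree (K : kripke) : tree :=
  Node 0 [Leaf (kw_n K); Node 0 (map edge_tree (kw_edges K));
          Node 0 (map label_tree (kw_lab K)); Leaf (kw_root K)].

Definition instance_tree (K : kripke) (f : ltl) : tree :=
  Node 0 [kripke_tree K; ltl_tree f].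

Lemma enc_aterm_tree t : enc_aterm t = enc_tree (aterm_tree t).
Proof. induction t; cbn; congruence. Qed.

Lemma enc_soa_tree f : enc_soa f = enc_tree (soa_tree f).
Proof.
  induction f; cbn [enc_soa soa_tree enc_tree map];
    rewrite <- ?enc_aterm_tree, ?IHf, ?IHf1, ?IHf2; auto.
  unfold enc_list. rewrite map_map. do 3 f_equal. f_equal.
  apply map_ext, enc_aterm_tree.
Qed.

Lemma enc_ltl_tree f : enc_ltl f = enc_tree (ltl_tree f).
Proof. induction f; cbn [enc_ltl ltl_tree enc_tree map]; congruence. Qed.

Lemma enc_kripke_tree K : enc_kripke K = enc_tree (kripke_tree K).
Proof.
  unfold enc_kripke, kripke_tree.
  rewrite (map_ext (fun '(v, w) => node 0 [enc_nat v; enc_nat w])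
             (fun e => enc_tree (edge_tree e))) by now intros [v w].
  rewrite (map_ext (fun l => enc_list (map enc_nat l))
             (fun l => enc_tree (label_tree l)))
    by (intros l; apply (enc_list_forest Leaf)).
  rewrite !enc_list_forest. reflexivity.
Qed.

Lemma enc_instance_tree K f : enc_instance K f = enc_tree (instance_tree K f).
Proof. unfold enc_instance. now rewrite enc_kripke_tree, enc_ltl_tree. Qed.

Lemma aterm_tree_inj s t : aterm_tree s = aterm_tree t -> s = t.
Proof.
  revert t; induction s; intros []; cbn; intros H; try discriminate; auto;
    injection H; intros; f_equal; auto.
Qed.

Lemma soa_tree_inj f g : soa_tree f = soa_tree g -> f = g.
Proof.
  revert g; induction f; intros []; cbn; intros H; try discriminate;
    injection H; intros; f_equal; eauto using aterm_tree_inj, map_inj.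
Qed.

Lemma ltl_tree_inj f g : ltl_tree f = ltl_tree g -> f = g.
Proof.
  revert g; induction f; intros []; cbn; intros H; try discriminate;
    injection H; intros; f_equal; auto.
Qed.

Lemma edge_tree_inj e e' : edge_tree e = edge_tree e' -> e = e'.
Proof. destruct e, e'. unfold edge_tree; cbn. congruence. Qed.

Lemma label_tree_inj l l' : label_tree l = label_tree l' -> l = l'.
Proof.
  intros H. injection H. apply map_inj. congruence.
Qed.

Lemma enc_tree_no_digit_app s t x y :
  no_digit (code x 0) -> no_digit (code y 0) ->
  enc_tree s ++ x = enc_tree t ++ y -> s = t /\ x = y.
Proof.
  intros Hx Hy H. apply (f_equal (fun w => code w 0)) in H.
  rewrite !code_app in H. apply enc_tree_readable in H as [-> H]; auto using code_inj.
Qed.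

(** It is the formula that ties the output of the transducer to its input; the structure stays
    existentially quantified in the language. *)
Lemma enc_instance_inj K f K' f' : enc_instance K f = enc_instance K' f' -> f = f'.
Proof.
  rewrite !enc_instance_tree. intros H.
  rewrite <- (app_nil_r (enc_tree _)), <- (app_nil_r (enc_tree (instance_tree K' f'))) in H.
  apply enc_tree_no_digit_app in H as [H _]; auto using no_digit_0.
  injection H. auto using ltl_tree_inj.
Qed.

(* No digit condition is needed: the encoding of a formula ends with [RPar]. *)
Lemma enc_node_prefix k k' cs cs' x y :
  enc_tree (Node k cs) ++ x = enc_tree (Node k' cs') ++ y ->
  Node k cs = Node k' cs' /\ x = y.
Proof.
  intros H. apply (f_equal (fun w => code w 0)) in H.
  rewrite !enc_tree_node in H. cbn [app] in H.
  apply code_heads_inj in H as [_ H].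
  rewrite !code_app in H.
  apply enc_nat_code_inj in H as [-> H]; auto using no_digit_forest.
  apply forest_code_inj in H as [-> H]. auto using code_inj.
Qed.

Lemma enc_soa_prefix f g x y : enc_soa f ++ x = enc_soa g ++ y -> f = g /\ x = y.
Proof.
  rewrite !enc_soa_tree. intros H.
  destruct (soa_tree f) eqn:Ef; [destruct f; discriminate |].
  destruct (soa_tree g) eqn:Eg; [destruct g; discriminate |].
  apply enc_node_prefix in H as [H ->]. split; auto.
  apply soa_tree_inj. congruence.
Qed.

(** * Formulas with a hole *)

(** The hole is always the last argument, so that a single [RPar] is all that a frame writes after
    it. *)
Inductive frame : Type :=
| HNot
| HAnd (g : soa)
| HOr (g : soa)
| HEx1 (i : nat)
| HAll1 (i : nat)
| HEx2 (X n : nat)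
| HAll2 (X n : nat).

Definition plug (h : frame) (f : soa) : soa :=
  match h with
  | HNot => SNot f
  | HAnd g => SAnd g f
  | HOr g => SOr g f
  | HEx1 i => SEx1 i f
  | HAll1 i => SAll1 i f
  | HEx2 X n => SEx2 X n f
  | HAll2 X n => SAll2 X n f
  end.

Definition fill (hs : list frame) (f : soa) : soa := fold_right plug f hs.

Definition enc_frame (h : frame) : list tok :=
  match h with
  | HNot => LPar :: enc_nat 3 ++ [Comma]
  | HAnd g => LPar :: enc_nat 4 ++ Comma :: enc_soa g ++ [Comma]
  | HOr g => LPar :: enc_nat 5 ++ Comma :: enc_soa g ++ [Comma]
  | HEx1 i => LPar :: enc_nat 6 ++ Comma :: enc_nat i ++ [Comma]
  | HAll1 i => LPar :: enc_nat 7 ++ Comma :: enc_nat i ++ [Comma]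
  | HEx2 X n => LPar :: enc_nat 8 ++ Comma :: enc_nat X ++ Comma :: enc_nat n ++ [Comma]
  | HAll2 X n => LPar :: enc_nat 9 ++ Comma :: enc_nat X ++ Comma :: enc_nat n ++ [Comma]
  end.

Definition enc_frames (hs : list frame) : list tok := flat_map enc_frame hs.

Lemma enc_soa_plug h f : enc_soa (plug h f) = enc_frame h ++ enc_soa f ++ [RPar].
Proof.
  destruct h; cbn [plug enc_soa enc_frame]; unfold node; cbn [flat_map];
    rewrite app_nil_r; cbn [app]; repeat (rewrite <- !app_assoc; cbn [app]); reflexivity.
Qed.

Lemma enc_soa_fill hs f :
  enc_soa (fill hs f) = enc_frames hs ++ enc_soa f ++ repeat RPar (length hs).
Proof.
  induction hs as [| h hs IH].
  - cbn. now rewrite app_nil_r.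
  - change (fill (h :: hs) f) with (plug h (fill hs f)).
    rewrite enc_soa_plug, IH.
    change (enc_frames (h :: hs)) with (enc_frame h ++ enc_frames hs).
    cbn [length]. rewrite <- !app_assoc. do 3 f_equal. symmetry. apply repeat_cons.
Qed.

Lemma enc_frames_app hs hs' : enc_frames (hs ++ hs') = enc_frames hs ++ enc_frames hs'.
Proof. apply flat_map_app. Qed.

(** This makes arbitrary output after the outer frames harmless: if the result is a formula at all,
    these frames are outermost in it. *)
Lemma enc_frames_prefix hs f u :
  enc_soa f = enc_frames hs ++ u -> exists g, f = fill hs g.
Proof.
  (* Below the first frame the subformula is followed by further tokens, so the induction needs a
     tail on the left as well. *)
  enough (forall x, enc_soa f ++ x = enc_frames hs ++ u -> exists g, f = fill hs g) as G
    by (intros H; apply (G []); now rewrite app_nil_r).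
  revert f u. induction hs as [| h hs IH]; intros f u x H; [now exists f |].
  assert (forall f' g' x' v, enc_soa f' ++ x' = enc_soa g' ++ v -> f' = g' /\ x' = v)
    as PS by apply enc_soa_prefix.
  change (enc_frames (h :: hs)) with (enc_frame h ++ enc_frames hs) in H.
  enough (exists f' x', f = plug h f' /\ enc_soa f' ++ x' = enc_frames hs ++ u)
    as (f' & x' & -> & H') by (apply IH in H' as [g ->]; now exists g).
  assert (forall m n v v', no_digit (code v 0) -> no_digit (code v' 0) ->
            enc_nat m ++ v = enc_nat n ++ v' -> m = n /\ v = v') as PN.
  { intros m n v v' Hv Hv' E. apply (enc_tree_no_digit_app (Leaf m) (Leaf n)) in E
      as [E ->]; auto. split; congruence. }
  destruct h, f; cbn [enc_soa enc_frame] in H; unfold node in H; cbn [flat_map] in H;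
    rewrite ?app_nil_r in H; cbn [app] in H; repeat (rewrite <- !app_assoc in H; cbn [app] in H);
    try discriminate H; cbn [plug].
  all: try (injection H as H).
  all: try (apply PS in H as [-> H]; try (injection H as H)).
  all: try (apply PN in H as [-> H]; try (injection H as H); try (now apply no_digit_code)).
  all: try (apply PN in H as [-> H]; try (injection H as H); try (now apply no_digit_code)).
  all: eexists _, _; split; [reflexivity | exact H].
Qed.

(** * Terms *)

(** Unary notation is affordable, since only constants bounded independently of the input are
    written this way. *)
Fixpoint numeral (n : nat) : aterm :=
  match n with 0 => AZero | S m => APlus AOne (numeral m) end.

Lemma aeval_numeral e n : aeval e (numeral n) = n.
Proof. induction n; cbn; congruence. Qed.

Definition code_term (w : list tok) (t : aterm) : aterm :=
  fold_right (fun a z => APlus (numeral (tok_code a)) (ATimes (numeral 6) z)) t w.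

Lemma aeval_code_term e w t : aeval e (code_term w t) = code w (aeval e t).
Proof.
  induction w as [| a w IH]; [reflexivity |].
  change (aeval e (numeral (tok_code a)) + aeval e (numeral 6) * aeval e (code_term w t)
          = tok_code a + 6 * code w (aeval e t)).
  now rewrite !aeval_numeral, IH.
Qed.

Lemma aclosed_numeral b n : aclosed b (numeral n) = true.
Proof. induction n; cbn; auto. Qed.

Lemma aclosed_code_term b w t : aclosed b (code_term w t) = aclosed b t.
Proof.
  induction w as [| a w IH]; [reflexivity |].
  cbn [code_term fold_right aclosed]. rewrite !aclosed_numeral. exact IH.
Qed.

Definition code_opener (a : tok) : list tok :=
  LPar :: enc_nat 3 ++ Comma :: enc_aterm (numeral (tok_code a)) ++
  Comma :: LPar :: enc_nat 4 ++ Comma :: enc_aterm (numeral 6) ++ [Comma].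

(** The openers follow the order of the letters and all closers are alike, so one sweep to the right
    and one back to the left produce the term. *)
Lemma enc_code_term w :
  enc_aterm (code_term w AZero) =
  flat_map code_opener w ++ enc_aterm AZero ++ flat_map (fun _ => [RPar; RPar]) w.
Proof.
  induction w as [| a w IH]; [reflexivity |].
  change (code_term (a :: w) AZero)
    with (APlus (numeral (tok_code a)) (ATimes (numeral 6) (code_term w AZero))).
  remember (numeral 6) as six. remember (numeral (tok_code a)) as ta.
  cbn [enc_aterm flat_map]. rewrite IH. unfold code_opener, node. rewrite <- Heqta, <- Heqsix.
  cbn [flat_map]. rewrite !app_nil_r. cbn [app]. repeat (rewrite <- !app_assoc; cbn [app]).
  do 10 f_equal.
  assert (forall u : list tok, flat_map (fun _ => [RPar; RPar]) u ++ [RPar; RPar]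
            = RPar :: RPar :: flat_map (fun _ : tok => [RPar; RPar]) u) as E
    by (induction u as [| b u IHu]; [reflexivity | cbn [flat_map app]; now rewrite IHu]).
  now rewrite E.
Qed.

(** The most significant digit is innermost: the openers are all alike and the digits sit in the
    closers, in input order. This calls for a sweep writing openers, a silent return, and a second
    sweep writing closers. *)
Definition binary_term (ds : list tok) : aterm :=
  fold_left (fun t d => APlus (ATimes (numeral 2) t) (numeral (digit_val d))) ds AZero.

Lemma aeval_binary_term e ds : aeval e (binary_term ds) = digits_val ds.
Proof.
  induction ds as [| d ds IH] using rev_ind; [reflexivity |].
  unfold binary_term. rewrite fold_left_app, digits_val_snoc. fold (binary_term ds).
  change (aeval e (numeral 2) * aeval e (binary_term ds) + aeval e (numeral (digit_val d))
          = 2 * digits_val ds + digit_val d).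
  now rewrite !aeval_numeral, IH.
Qed.

Lemma aclosed_binary_term b ds : aclosed b (binary_term ds) = true.
Proof.
  induction ds as [| d ds IH] using rev_ind; [reflexivity |].
  unfold binary_term. rewrite fold_left_app. fold (binary_term ds).
  change (aclosed b (numeral 2) && aclosed b (binary_term ds) && aclosed b (numeral (digit_val d)) = true).
  now rewrite !aclosed_numeral, IH.
Qed.

Definition binary_opener : list tok :=
  LPar :: enc_nat 3 ++ Comma :: LPar :: enc_nat 4 ++ Comma :: enc_aterm (numeral 2) ++ [Comma].

Definition binary_closer (d : tok) : list tok :=
  RPar :: Comma :: enc_aterm (numeral (digit_val d)) ++ [RPar].

Lemma enc_binary_term ds :
  enc_aterm (binary_term ds) =
  flat_map (fun _ => binary_opener) ds ++ enc_aterm AZero ++ flat_map binary_closer ds.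
Proof.
  induction ds as [| d ds IH] using rev_ind; [reflexivity |].
  unfold binary_term. rewrite fold_left_app. fold (binary_term ds).
  cbn [fold_left]. remember (numeral (digit_val d)) as td.
  assert (forall u : list tok, flat_map (fun _ => binary_opener) u ++ binary_opener
            = binary_opener ++ flat_map (fun _ : tok => binary_opener) u) as E.
  { induction u as [| b u IHu]; [now rewrite app_nil_r |].
    cbn [flat_map]. now rewrite <- app_assoc, IHu, app_assoc. }
  rewrite !flat_map_app. cbn [flat_map]. rewrite !app_nil_r, E, <- app_assoc.
  unfold binary_opener at 1, binary_closer at 2. rewrite <- Heqtd.
  remember (numeral 2) as two eqn:E2.
  cbn [enc_aterm]. rewrite IH. unfold node. cbn [flat_map]. rewrite !app_nil_r. cbn [app].
  repeat (rewrite <- !app_assoc; cbn [app]). reflexivity.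
Qed.

(** * Translation of LTL formulas *)

Definition ttrue : soa := SEq AZero AZero.
Definition ffalse : soa := SNot ttrue.
Definition Imp (f g : soa) : soa := SOr (SNot f) g.
Definition Iff (f g : soa) : soa := SAnd (Imp f g) (Imp g f).

Lemma ssat_Imp e1 e2 f g :
  ssat e1 e2 (Imp f g) <-> (ssat e1 e2 f -> ssat e1 e2 g).
Proof. cbn. destruct (classic (ssat e1 e2 f)); tauto. Qed.

Lemma ssat_Iff e1 e2 f g :
  ssat e1 e2 (Iff f g) <-> (ssat e1 e2 f <-> ssat e1 e2 g).
Proof.
  unfold Iff. cbn [ssat]. rewrite !ssat_Imp. tauto.
Qed.

(* A team is coded by a set [X] of indices and a time [k]: it consists of the
   [k]-th suffixes of the traces number [n], [n] in [X], of a fixed enumeration,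
   which is the ternary relation number 0. The number variable 1 is [k], and the
   set variable 1 is [X]; variables 2 and 3 select the left argument of a binary
   connective if they differ and the right one if they are equal.
   Every connective has the same number of frames, so that the transducer can
   close them without remembering the connective. *)
Definition op_frames (k : nat) : list frame :=
  let pad n := repeat (HAnd ttrue) n in
  match k with
  | 1 => pad 2 ++ [HAll1 3; HOr (SNot (SApp 1 [AVar 3])); HEx2 1 1;
                   HAnd (SAll1 4 (Iff (SApp 1 [AVar 4]) (SEq (AVar 4) (AVar 3)))); HNot]
  | 2 => pad 5 ++ [HAll1 2; HAll1 3]
  | 3 => [HEx2 2 1; HEx2 3 1;
          HAnd (SAll1 4 (Iff (SApp 1 [AVar 4]) (SOr (SApp 2 [AVar 4]) (SApp 3 [AVar 4]))));
          HAll1 2; HAll1 3; HEx2 1 1;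
          HAnd (SAll1 4 (Iff (SApp 1 [AVar 4])
                  (SOr (SAnd (SEq (AVar 2) (AVar 3)) (SApp 3 [AVar 4]))
                       (SAnd (SNot (SEq (AVar 2) (AVar 3))) (SApp 2 [AVar 4])))))]
  (* Rebinding the time hides its old value, so the new time is first fixed in variable 3 and then
     copied. *)
  | 4 => pad 3 ++ [HEx1 3; HAnd (SEq (AVar 3) (APlus (AVar 1) AOne));
                   HEx1 1; HAnd (SEq (AVar 1) (AVar 3))]
  | 5 => pad 3 ++ [HEx1 3; HAnd (SLe (AVar 1) (AVar 3)); HEx1 1; HAnd (SEq (AVar 1) (AVar 3))]
  | 6 => pad 3 ++ [HAll1 3; HOr (SNot (SLe (AVar 1) (AVar 3)));
                   HEx1 1; HAnd (SEq (AVar 1) (AVar 3))]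
  (* For the until and release operators the selecting variables are themselves times: variable 2
     ranges up to variable 3, and only at equality is the right operand evaluated. *)
  | 7 => pad 1 ++ [HEx1 3; HAnd (SLe (AVar 1) (AVar 3));
                   HAll1 2; HOr (SNot (SAnd (SLe (AVar 1) (AVar 2)) (SLe (AVar 2) (AVar 3))));
                   HEx1 1; HAnd (SEq (AVar 1) (AVar 2))]
  | 8 => pad 1 ++ [HAll1 3; HOr (SNot (SLe (AVar 1) (AVar 3)));
                   HEx1 2; HAnd (SAnd (SLe (AVar 1) (AVar 2)) (SLe (AVar 2) (AVar 3)));
                   HEx1 1; HAnd (SEq (AVar 1) (AVar 2))]
  | _ => pad 6 ++ [HNot]
  end.

Definition is_right : soa := SEq (AVar 2) (AVar 3).

(** The two neutral frames stand in for the guards of a binary connective and equalise the number of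
    closing parentheses. *)
Definition unary_frames (k : nat) : list frame :=
  op_frames k ++ [HAnd ttrue; HOr ffalse].

(** The left operand sits inside a frame and the right one in the hole: each is written once, in the
    order of the input. *)
Definition binary_frames (k : nat) (f : soa) : list frame :=
  op_frames k ++ [HAnd (SOr is_right f); HOr (SNot is_right)].

Definition atom_frames : list frame := [HAll1 3; HOr (SNot (SApp 1 [AVar 3]))].

Definition atom_formula (ds : list tok) : soa :=
  fill atom_frames (SApp 0 [AVar 3; AVar 1; binary_term ds]).

Fixpoint tr (f : ltl) : soa :=
  match f with
  | LAtom p => atom_formula (enc_nat p)
  | LNeg a => fill (unary_frames 1) (tr a)
  | LAnd a b => fill (binary_frames 2 (tr a)) (tr b)
  | LOr a b => fill (binary_frames 3 (tr a)) (tr b)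
  | LX a => fill (unary_frames 4) (tr a)
  | LF a => fill (unary_frames 5) (tr a)
  | LG a => fill (unary_frames 6) (tr a)
  | LU a b => fill (binary_frames 7 (tr a)) (tr b)
  | LR a b => fill (binary_frames 8 (tr a)) (tr b)
  | LTilde a => fill (unary_frames 9) (tr a)
  end.

Definition atom_opener : list tok :=
  enc_frames atom_frames ++
  LPar :: enc_nat 2 ++ Comma :: enc_nat 0 ++ Comma :: LPar :: enc_nat 0 ++
  Comma :: enc_aterm (AVar 3) ++ Comma :: enc_aterm (AVar 1) ++ [Comma].

Definition binary_prefix (k : nat) : list tok :=
  enc_frames (op_frames k) ++
  LPar :: enc_nat 4 ++ Comma :: LPar :: enc_nat 5 ++ Comma :: enc_soa is_right ++ [Comma].

(** Independent of the connective, so a comma between operands can be translated without remembering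
    which node it belongs to. *)
Definition binary_middle : list tok :=
  RPar :: Comma :: enc_frame (HOr (SNot is_right)).

Lemma enc_atom_formula ds :
  enc_soa (atom_formula ds) =
  atom_opener ++ enc_aterm (binary_term ds) ++ repeat RPar 4.
Proof.
  unfold atom_formula. rewrite enc_soa_fill. unfold atom_opener.
  rewrite <- !app_assoc. f_equal. remember (binary_term ds) as t.
  cbn [enc_soa map enc_list]. unfold enc_list, node. cbn [flat_map].
  rewrite !app_nil_r. cbn [app]. repeat (rewrite <- !app_assoc; cbn [app]). reflexivity.
Qed.

Lemma op_frames_length k : 1 <= k <= 9 -> length (op_frames k) = 7.
Proof. intros H. do 10 (destruct k as [| k]; [try reflexivity; lia |]). lia. Qed.

Lemma enc_unary k f : 1 <= k <= 9 ->
  enc_soa (fill (unary_frames k) f) =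
  enc_frames (unary_frames k) ++ enc_soa f ++ repeat RPar 9.
Proof.
  intros H. rewrite enc_soa_fill. do 3 f_equal. unfold unary_frames.
  now rewrite length_app, op_frames_length.
Qed.

Lemma enc_binary k f g : 1 <= k <= 9 ->
  enc_soa (fill (binary_frames k f) g) =
  binary_prefix k ++ enc_soa f ++ binary_middle ++ enc_soa g ++ repeat RPar 9.
Proof.
  intros H. rewrite enc_soa_fill. unfold binary_frames at 2.
  rewrite length_app, op_frames_length by auto. cbn [length Nat.add].
  unfold binary_frames, binary_prefix, binary_middle. rewrite enc_frames_app, <- !app_assoc.
  f_equal. remember is_right as r. cbn [enc_frames flat_map enc_frame enc_soa].
  unfold node. cbn [flat_map]. rewrite !app_nil_r. cbn [app].
  repeat (rewrite <- !app_assoc; cbn [app]). reflexivity.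
Qed.

Lemma closed_tr f : forall b1 b2,
  existsb (Nat.eqb 1) b1 = true ->
  existsb (fun '(Y, m) => Nat.eqb 0 Y && Nat.eqb 3 m) b2 = true ->
  existsb (fun '(Y, m) => Nat.eqb 1 Y && Nat.eqb 1 m) b2 = true ->
  sclosed b1 b2 (tr f) = true.
Proof.
  induction f; intros b1 b2 H1 H2 H3; cbn -[existsb binary_term];
    [remember (binary_term (enc_nat p)) as t eqn:Et;
     assert (forall b, aclosed b t = true) as Ht by (intros b; rewrite Et; apply (aclosed_binary_term b (enc_nat p))) | ..];
    cbn in *; rewrite ?H1, ?H2, ?H3, ?Ht, ?IHf, ?IHf1, ?IHf2; auto.
Qed.

(** * Correctness of the translation *)

Definition indexed_team (e : nat -> trace) (k : nat) (X : nat -> Prop) : team :=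
  fun t => exists n, X n /\ t = tsuffix (e n) k.

Lemma trace_ext (t u : trace) : (forall i p, t i p = u i p) -> t = u.
Proof.
  intros H. apply functional_extensionality; intros i.
  apply functional_extensionality, H.
Qed.

Lemma tsat_ext f : forall S T : team, (forall t, S t <-> T t) -> tsat S f <-> tsat T f.
Proof.
  assert (forall (S T : team) k, (forall t, S t <-> T t) ->
            forall t, team_suffix S k t <-> team_suffix T k t) as HS.
  { intros S T k H t. unfold team_suffix. now setoid_rewrite H. }
  induction f; intros S T H; cbn [tsat].
  - now setoid_rewrite H.
  - now setoid_rewrite H.
  - now rewrite (IHf1 S T), (IHf2 S T).
  - now setoid_rewrite H.
  - auto.
  - split; intros [k Hk]; exists k; revert Hk; apply IHf, HS; firstorder.
  - split; intros Hk k; generalize (Hk k); apply IHf, HS; firstorder.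
  - split; intros (k & Hk & Hj); exists k; split.
    + revert Hk; apply IHf2, HS; firstorder.
    + intros j L; generalize (Hj j L); apply IHf1, HS; firstorder.
    + revert Hk; apply IHf2, HS; firstorder.
    + intros j L; generalize (Hj j L); apply IHf1, HS; firstorder.
  - split; intros Hk k; (destruct (Hk k) as [Hb | (j & L & Ha)];
      [left; revert Hb; apply IHf2, HS; firstorder
      | right; exists j; split; auto; revert Ha; apply IHf1, HS; firstorder]).
  - now rewrite (IHf S T).
Qed.

Lemma tsuffix_add t j k : tsuffix (tsuffix t j) k = tsuffix t (j + k).
Proof. apply trace_ext; intros i p. unfold tsuffix. f_equal. lia. Qed.

Lemma indexed_team_suffix e j k X t :
  team_suffix (indexed_team e j X) k t <-> indexed_team e (j + k) X t.
Proof.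
  unfold team_suffix, indexed_team. split.
  - intros (u & (n & Hn & ->) & H). exists n. split; auto.
    rewrite <- tsuffix_add. now apply trace_ext.
  - intros (n & Hn & ->). exists (tsuffix (e n) j). split; [now exists n |].
    now rewrite <- tsuffix_add.
Qed.

Lemma indexed_team_singleton e k n t :
  singleton (tsuffix (e n) k) t <-> indexed_team e k (fun m => m = n) t.
Proof.
  unfold singleton, indexed_team. split.
  - intros H. exists n. split; auto. now apply trace_ext.
  - intros (m & -> & ->). auto.
Qed.

Lemma indexed_team_ext e k X Y t :
  (forall n, X n <-> Y n) -> indexed_team e k X t <-> indexed_team e k Y t.
Proof. intros H. unfold indexed_team. now setoid_rewrite H. Qed.

Lemma tsat_suffix e j k X f :
  tsat (team_suffix (indexed_team e j X) k) f <-> tsat (indexed_team e (j + k) X) f.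
Proof. apply tsat_ext. intros t. apply indexed_team_suffix. Qed.

Lemma tsat_indexed_ext e k X Y f :
  (forall n, X n <-> Y n) ->
  tsat (indexed_team e k X) f <-> tsat (indexed_team e k Y) f.
Proof. intros H. apply tsat_ext. intros t. now apply indexed_team_ext. Qed.

(* Since traces are extensional, a splitting of an indexed team comes from a
   splitting of its set of indices. *)
Lemma tsat_indexed_or e k X f g :
  tsat (indexed_team e k X) (LOr f g) <->
  exists Y Z : nat -> Prop, (forall n, X n <-> Y n \/ Z n) /\
    tsat (indexed_team e k Y) f /\ tsat (indexed_team e k Z) g.
Proof.
  cbn [tsat]. split.
  - intros (S & U & H & HS & HU).
    (* Several indices may yield the same suffix; pulling back along the enumeration treats them
       alike. *)
    exists (fun n => X n /\ S (tsuffix (e n) k)), (fun n => X n /\ U (tsuffix (e n) k)).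
    assert (forall V : team, (forall t, V t -> S t \/ U t) ->
              forall t, indexed_team e k (fun n => X n /\ V (tsuffix (e n) k)) t <-> V t)
      as HV.
    { intros V HV t. unfold indexed_team. split.
      - now intros (n & (_ & Hn) & ->).
      - intros Ht. destruct (proj2 (H t) (HV t Ht)) as (n & Hn & ->). now exists n. }
    repeat split.
    + intros Hn. destruct (proj1 (H (tsuffix (e n) k))); auto. now exists n.
    + tauto.
    + revert HS. apply tsat_ext. intros t. apply (HV S). auto.
    + revert HU. apply tsat_ext. intros t. apply (HV U). auto.
  - intros (Y & Z & H & HY & HZ).
    exists (indexed_team e k Y), (indexed_team e k Z). repeat split; auto.
    + intros (n & Hn & ->). apply H in Hn as [Hn | Hn]; [left | right]; now exists n.
    + unfold indexed_team. intros [(n & Hn & ->) | (n & Hn & ->)]; exists n; split; auto;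
        apply H; auto.
Qed.

Lemma ssat_unary k e1 e2 f :
  ssat e1 e2 (fill (unary_frames k) f) <-> ssat e1 e2 (fill (op_frames k) f).
Proof.
  enough (forall hs e1 e2,
    ssat e1 e2 (fill (hs ++ [HAnd ttrue; HOr ffalse]) f) <-> ssat e1 e2 (fill hs f)) as E
    by apply E.
  clear. induction hs as [| h hs IH]; intros e1 e2.
  - cbn. tauto.
  - destruct h; cbn [app fill fold_right plug ssat];
      fold (fill hs f); fold (fill (hs ++ [HAnd ttrue; HOr ffalse]) f);
      try setoid_rewrite IH; reflexivity.
Qed.

Lemma ssat_pad n e1 e2 hs f :
  ssat e1 e2 (fill (repeat (HAnd ttrue) n ++ hs) f) <-> ssat e1 e2 (fill hs f).
Proof. induction n; [reflexivity |]. cbn in *. tauto. Qed.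

Definition set1 (e2 : env2) : nat -> Prop := fun n => e2 1 1 [n].

Definition enumerates (e2 : env2) (e : nat -> trace) : Prop :=
  forall n i p, e2 0 3 [n; i; p] <-> e n i p = true.

(** The environments are arbitrary because the frames change them; the value depends on them only
    through the time, the index set and the enumeration, and the last is never rebound. *)
Lemma ssat_tr e f : forall e1 e2, enumerates e2 e ->
  ssat e1 e2 (tr f) <-> tsat (indexed_team e (e1 1) (set1 e2)) f.
Proof.
  assert (forall e2 n S, enumerates e2 e -> enumerates (upd2 e2 (Datatypes.S n) 1 S) e) as HU.
  { intros e2 n S H m i p. apply H. }
  induction f; intros e1 e2 He; cbn [tr].
  - cbn -[binary_term enc_nat].
    setoid_rewrite aeval_binary_term. rewrite enc_nat_val. split.
    + intros H t (n & Hn & ->). destruct (H n) as [H' | H']; [contradiction |].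
      now apply He in H'.
    + intros H n. destruct (classic (e2 1 1 [n])) as [Hn | Hn]; [right | left; exact Hn].
      apply He. apply (H (tsuffix (e n) (e1 1))). now exists n.
  - rewrite ssat_unary. cbn [op_frames]. rewrite ssat_pad.
    cbn -[Iff ssat tr]. cbn [ssat]. cbn [length map aeval ].
    assert (forall m S, (forall i, S [i] <-> i = m) ->
       ssat (upd1 e1 3 m) (upd2 e2 1 1 S) (tr f) <->
       tsat (singleton (tsuffix (e m) (e1 1))) f) as E.
    { intros m S HS. rewrite IHf by now apply HU.
      rewrite (tsat_ext f _ _ (indexed_team_singleton e (e1 1) m)).
      apply tsat_indexed_ext. exact HS. }
    setoid_rewrite ssat_Iff. cbn. split.
    + intros H t (n & Hn & ->) Ht. destruct (H n) as [H' | (S & HS & H')]; [contradiction |].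
      apply H'. now apply E.
    + intros H m. destruct (classic (e2 1 1 [m])) as [Hn | Hn]; [right | left; exact Hn].
      exists (fun l => l = [m]). split; [intros v; cbn; split; congruence |].
      rewrite E by (intros i; split; congruence). apply H. now exists m.
  - unfold binary_frames; cbn [op_frames]. rewrite <- app_assoc, ssat_pad.
    cbn -[ssat tr is_right]. cbn [ssat].
    cbn. split.
    + intros H. split.
      (* Distinct values of the selecting variables give the left operand, equal values the right
         one. *)
      * destruct (H 0 1) as [[H' | H'] _]; [discriminate |]. now apply IHf1 in H'.
      * destruct (H 0 0) as [_ [H' | H']]; [contradiction |]. now apply IHf2 in H'.
    + intros [Ha Hb] j m. destruct (Nat.eq_dec j m); split; auto; right.
      * now apply IHf2.
      * now apply IHf1.
  - rewrite tsat_indexed_or. cbn -[Iff ssat tr is_right]. cbn [ssat].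
    setoid_rewrite ssat_Iff. cbn. split.
    + intros (Y & Z & H & H').
      exists (fun n => Y [n]), (fun n => Z [n]). split; [exact H |]. split.
      * destruct (H' 0 1) as (W & HW & [H'' | H''] & _); [discriminate |].
        apply IHf1 in H''; [| now do 3 apply HU]. revert H''.
        apply tsat_indexed_ext. intros n. unfold set1; cbn. rewrite HW.
        intuition discriminate.
      * destruct (H' 0 0) as (W & HW & _ & [H'' | H'']); [contradiction |].
        apply IHf2 in H''; [| now do 3 apply HU]. revert H''.
        apply tsat_indexed_ext. intros n. unfold set1; cbn. rewrite HW.
        intuition.
    + intros (Y & Z & H & Ha & Hb).
      exists (fun l => Y (hd 0 l)), (fun l => Z (hd 0 l)). split; [exact H |].
      intros j m. destruct (Nat.eq_dec j m) as [-> | N].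
      * exists (fun l => Z (hd 0 l)). split; [intros i; tauto |]. split; auto; right.
        apply IHf2; [now do 3 apply HU |]. exact Hb.
      * exists (fun l => Y (hd 0 l)). split; [intros i; tauto |]. split; auto; right.
        apply IHf1; [now do 3 apply HU |]. exact Ha.
  - rewrite ssat_unary. cbn [op_frames]. rewrite ssat_pad. cbn [tsat].
    rewrite tsat_suffix. cbn -[ssat tr]. cbn [ssat]. cbn -[tr Nat.add]. split.
    + intros (m & -> & k & -> & H). now apply IHf in H.
    + intros H. exists (e1 1 + 1). split; auto. exists (e1 1 + 1). split; auto. now apply IHf.
  - rewrite ssat_unary. cbn [op_frames]. rewrite ssat_pad. cbn [tsat].
    setoid_rewrite tsat_suffix. cbn -[ssat tr]. cbn [ssat]. cbn -[tr]. split.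
    (* The formula quantifies over absolute times from the current one on, the semantics over
       offsets. *)
    + intros (m & L & k & -> & H). apply IHf in H; [| exact He]. exists (m - e1 1). cbn in H.
      now replace (e1 1 + (m - e1 1)) with m by lia.
    + intros (k & H). exists (e1 1 + k). split; [lia |]. exists (e1 1 + k). split; auto.
      now apply IHf.
  - rewrite ssat_unary. cbn [op_frames]. rewrite ssat_pad. cbn [tsat].
    setoid_rewrite tsat_suffix. cbn -[ssat tr]. cbn [ssat]. cbn -[tr]. split.
    + intros H k. destruct (H (e1 1 + k)) as [H' | (m & -> & H')]; [lia |].
      now apply IHf in H'.
    + intros H m. destruct (le_dec (e1 1) m) as [L | L]; [right | now left].
      exists m. split; auto. apply IHf; [exact He |]. cbn.
      replace m with (e1 1 + (m - e1 1)) by lia. apply H.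
  - unfold binary_frames; cbn [op_frames]. rewrite <- app_assoc, ssat_pad.
    cbn [tsat]. setoid_rewrite tsat_suffix.
    cbn -[ssat tr is_right]. cbn [ssat]. cbn -[tr]. split.
    + intros (m & L & H). exists (m - e1 1). split.
      * destruct (H m) as [H' | (k & -> & _ & [H' | H'])]; [lia | contradiction |].
        apply IHf2 in H'; [| exact He]. cbn in H'. now replace (e1 1 + (m - e1 1)) with m by lia.
      * intros j Lj. destruct (H (e1 1 + j)) as [H' | (k & -> & [H' | H'] & _)]; [lia | lia |].
        now apply IHf1 in H'.
    + intros (k & Hb & Ha). exists (e1 1 + k). split; [lia |]. intros j.
      destruct (classic (e1 1 <= j /\ j <= e1 1 + k)) as [L | L]; [right | now left].
      exists j. split; auto. destruct (Nat.eq_dec j (e1 1 + k)) as [-> | N]; split; auto; right.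
      * now apply IHf2.
      * apply IHf1; [exact He |]. cbn. replace j with (e1 1 + (j - e1 1)) by lia.
        apply Ha. lia.
  - unfold binary_frames; cbn [op_frames]. rewrite <- app_assoc, ssat_pad.
    cbn [tsat]. setoid_rewrite tsat_suffix.
    cbn -[ssat tr is_right]. cbn [ssat]. cbn -[tr]. split.
    + intros H k. destruct (H (e1 1 + k)) as [H' | (j & L & i & -> & Ha & Hb)]; [lia |].
      destruct (Nat.eq_dec j (e1 1 + k)) as [-> | N].
      * left. destruct Hb as [Hb | Hb]; [contradiction |]. now apply IHf2 in Hb.
      * right. exists (j - e1 1). split; [lia |].
        destruct Ha as [Ha | Ha]; [contradiction |].
        apply IHf1 in Ha; [| exact He]. cbn in Ha.
        now replace (e1 1 + (j - e1 1)) with j by lia.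
    + intros H m. destruct (le_dec (e1 1) m) as [L | L]; [right | now left].
      destruct (H (m - e1 1)) as [Hb | (j & Lj & Ha)].
      * exists m. split; [lia |]. exists m. split; auto. split; auto. right.
        apply IHf2; [exact He |]. cbn. now replace m with (e1 1 + (m - e1 1)) by lia.
      * exists (e1 1 + j). split; [lia |]. exists (e1 1 + j). split; auto.
        split; [right | left; lia]. now apply IHf1.
  - rewrite ssat_unary. cbn [op_frames]. rewrite ssat_pad. cbn [tsat].
    cbn -[ssat tr]. cbn [ssat]. now rewrite IHf.
Qed.

(** * A grammar in second-order arithmetic *)

Definition conj (fs : list soa) : soa := fold_right SAnd ttrue fs.

Definition all1 (vs : list nat) (f : soa) : soa := fold_right SAll1 f vs.

Lemma ssat_conj e1 e2 fs : ssat e1 e2 (conj fs) <-> (forall f, In f fs -> ssat e1 e2 f).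
Proof.
  induction fs as [| f fs IH]; cbn.
  - split; [contradiction | auto].
  - change (fold_right SAnd ttrue fs) with (conj fs). rewrite IH.
    split; [intros [H1 H2] g [<- | Hg]; auto | auto].
Qed.

Lemma ssat_all1 vs f e1 e2 :
  ssat e1 e2 (all1 vs f) <->
  (forall e, (forall i, ~ In i vs -> e i = e1 i) -> ssat e e2 f).
Proof.
  revert e1; induction vs as [| i vs IH]; intros e1.
  - cbn. split; [| auto]. intros H e He.
    replace e with e1; auto. apply functional_extensionality. symmetry. auto.
  - change (all1 (i :: vs) f) with (SAll1 i (all1 vs f)). cbn [ssat].
    setoid_rewrite IH. unfold upd1. split.
    + intros H e He. apply (H (e i)). intros j Hj.
      destruct (Nat.eqb_spec j i) as [-> | N]; auto.
      apply He. intros [-> | K]; auto.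
    + intros H v e He. apply H. intros j Hj.
      rewrite He by (intros K; apply Hj; now right).
      destruct (Nat.eqb_spec j i) as [-> | N]; auto. destruct Hj; now left.
Qed.

(* A Horn clause: the premises and the conclusion of a rule for a 4-ary relation. *)
Definition rule : Type := (list (list aterm) * list aterm)%type.

Definition rule_vars : list nat := [10; 11; 12; 13; 14; 15].

(** The relation symbol is a parameter: symbol 4 is the relation being defined, symbol 5 its
    competitor in the minimality condition. *)
Definition rule_formula (Y : nat) (r : rule) : soa :=
  all1 rule_vars (fold_right (fun p g => Imp (SApp Y p) g) (SApp Y (snd r)) (fst r)).

Definition fact (tag : nat) (n x y : aterm) : list aterm := [numeral tag; n; x; y].

Definition node_start (k : nat) : list tok := LPar :: enc_nat k ++ [Comma].

(* The fact [tag n x y] says that the input [x] starts with a word of the kind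
   given by [tag], and that [y] is the rest of the input. The kinds are
   0: the number [n]; 1: items of a list of numbers; 2: items of a list of edges;
   3: [n] items of a list of labels; 4: an LTL formula. *)
Definition rules : list rule :=
  let n := AVar 10 in let x := AVar 11 in let y := AVar 12 in
  let z := AVar 13 in let m := AVar 14 in let x' := AVar 15 in
  [ ([], fact 0 AZero (code_term [D0] y) y);
    ([], fact 0 (numeral 1) (code_term [D1] y) y);
    (* A digit is appended only to a positive number, which excludes leading zeros. *)
    ([fact 0 (APlus n (numeral 1)) x (code_term [D0] y)],
     fact 0 (ATimes (numeral 2) (APlus n (numeral 1))) x y);
    ([fact 0 (APlus n (numeral 1)) x (code_term [D1] y)],
     fact 0 (APlus (ATimes (numeral 2) (APlus n (numeral 1))) (numeral 1)) x y);
    ([], fact 1 AZero y y);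
    ([fact 0 n x z; fact 1 AZero z y], fact 1 AZero (code_term [Comma] x) y);
    ([], fact 2 AZero y y);
    ([fact 0 n x (code_term [Comma] x'); fact 0 m x' (code_term [RPar] z); fact 2 AZero z y],
     fact 2 AZero (code_term (Comma :: node_start 0) x) y);
    ([], fact 3 AZero y y);
    (* A label may be empty, so the comma belongs to its items and not to the opening of the node,
       unlike for edges. *)
    ([fact 1 AZero x (code_term [RPar] z); fact 3 n z y],
     fact 3 (APlus n (numeral 1)) (code_term [Comma; LPar; D0] x) y);
    ([fact 0 n x (code_term [RPar] y)], fact 4 AZero (code_term (node_start 0) x) y) ]
  ++ map (fun k => ([fact 4 AZero x (code_term [RPar] y)],
                    fact 4 AZero (code_term (node_start k) x) y)) [1; 4; 5; 6; 9]
  ++ map (fun k => ([fact 4 AZero x (code_term [Comma] z); fact 4 AZero z (code_term [RPar] y)],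
                    fact 4 AZero (code_term (node_start k) x) y)) [2; 3; 7; 8].

Definition rules_formula (Y : nat) : soa := conj (map (rule_formula Y) rules).

Definition closed_under_rules (e1 : nat -> nat) (S : list nat -> Prop) : Prop :=
  forall r e, In r rules -> (forall i, ~ In i rule_vars -> e i = e1 i) ->
    Forall (fun p => S (map (aeval e) p)) (fst r) -> S (map (aeval e) (snd r)).

Lemma rules_arity r : In r rules -> forall p, In p (snd r :: fst r) -> length p = 4.
Proof.
  assert (forallb (fun r => forallb (fun p => length p =? 4) (snd r :: fst r)) rules = true) as H
    by reflexivity.
  intros Hr p Hp. rewrite forallb_forall in H. apply H in Hr.
  rewrite forallb_forall in Hr. now apply Nat.eqb_eq, Hr.
Qed.

Lemma ssat_premises e1 e2 Y ps f :
  ssat e1 e2 (fold_right (fun p g => Imp (SApp Y p) g) f ps) <->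
  ((forall p, In p ps -> e2 Y (length p) (map (aeval e1) p)) -> ssat e1 e2 f).
Proof.
  induction ps as [| p ps IH]; [cbn; firstorder |].
  cbn [fold_right]. rewrite ssat_Imp, IH. cbn [ssat In]. split.
  - intros H K. apply H; auto.
  - intros H K1 K2. apply H. intros q [<- | Hq]; auto.
Qed.

Lemma ssat_rules e1 e2 Y :
  ssat e1 e2 (rules_formula Y) <-> closed_under_rules e1 (e2 Y 4).
Proof.
  unfold rules_formula, closed_under_rules. rewrite ssat_conj. split.
  - intros H r e Hr He Hp.
    assert (ssat e1 e2 (rule_formula Y r)) as H' by (apply H, in_map, Hr).
    unfold rule_formula in H'. rewrite ssat_all1 in H'. specialize (H' e He).
    rewrite ssat_premises in H'. cbn [ssat] in H'.
    rewrite (rules_arity r Hr) in H' by now left.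
    apply H'. intros p Ip. rewrite (rules_arity r Hr) by now right.
    rewrite Forall_forall in Hp. auto.
  - intros H f Hf. apply in_map_iff in Hf as (r & <- & Hr).
    unfold rule_formula. rewrite ssat_all1. intros e He.
    rewrite ssat_premises. cbn [ssat]. rewrite (rules_arity r Hr) by now left.
    intros Hp. apply (H r e Hr He), Forall_forall. intros p Ip.
    specialize (Hp p Ip). rewrite (rules_arity r Hr) in Hp by now right. auto.
Qed.

(** The least fixed point of the rules in closed form. *)
Definition parses (tag n x y : nat) : Prop :=
  match tag with
  | 0 => x = code (enc_nat n) y
  | 1 => exists l, n = 0 /\ x = code (forest (map Leaf l)) y
  | 2 => exists l, n = 0 /\ x = code (forest (map edge_tree l)) y
  | 3 => exists l, n = length l /\ x = code (forest (map label_tree l)) y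
  | 4 => exists f, n = 0 /\ x = code (enc_tree (ltl_tree f)) y
  | _ => False
  end.

Definition parse_set (l : list nat) : Prop :=
  match l with [tag; n; x; y] => parses tag n x y | _ => False end.

Lemma code_cons a w y : code (a :: w) y = code [a] (code w y).
Proof. reflexivity. Qed.

Lemma code_enc_node k cs y :
  code (enc_tree (Node k cs)) y =
  code [LPar] (code (enc_nat k) (code (forest cs) (code [RPar] y))).
Proof. now rewrite enc_tree_node, code_cons, !code_app. Qed.

Lemma code_forest_cons t cs y :
  code (forest (t :: cs)) y = code [Comma] (code (enc_tree t) (code (forest cs) y)).
Proof. now rewrite forest_cons, code_cons, code_app. Qed.

Lemma code_node_start k y :
  code (node_start k) y = code [LPar] (code (enc_nat k) (code [Comma] y)).
Proof. unfold node_start. now rewrite code_cons, code_app. Qed.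

Lemma code_node1 k t y :
  code (enc_tree (Node k [t])) y = code (node_start k) (code (enc_tree t) (code [RPar] y)).
Proof. now rewrite code_enc_node, code_forest_cons, code_node_start. Qed.

Lemma code_node2 k t u y :
  code (enc_tree (Node k [t; u])) y =
  code (node_start k) (code (enc_tree t) (code [Comma] (code (enc_tree u) (code [RPar] y)))).
Proof. now rewrite code_enc_node, !code_forest_cons, code_node_start. Qed.

Lemma parse_set_fact e tag n x y :
  parse_set (map (aeval e) (fact tag n x y)) = parses tag (aeval e n) (aeval e x) (aeval e y).
Proof. unfold fact. cbn [map]. now rewrite aeval_numeral. Qed.

Lemma parse_set_closed e1 : closed_under_rules e1 parse_set.
Proof.
  intros r e Hr _ Hp. unfold rules in Hr.
  assert (forall n, aeval e (APlus n (numeral 1)) = S (aeval e n)) as ES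
    by (intros n; cbn [aeval]; rewrite aeval_numeral; lia).
  assert (forall n, aeval e (ATimes (numeral 2) n) = 2 * aeval e n) as ET
    by (intros n; cbn [aeval]; now rewrite aeval_numeral).
  apply in_app_or in Hr as [Hr | Hr]; [| apply in_app_or in Hr as [Hr | Hr]].
  - repeat destruct Hr as [<- | Hr]; try contradiction Hr;
      unfold fst, snd in *;
      repeat match goal with H : Forall _ (_ :: _) |- _ => apply Forall_cons_iff in H as [? H] end;
      clear Hp; rewrite !parse_set_fact in *; cbn [parses] in *;
      rewrite ?aeval_code_term, ?ES, ?ET, ?ES, ?aeval_code_term in *.
    + reflexivity.
    + reflexivity.
    + now rewrite H, enc_nat_double, code_app.
    + replace (S (2 * S (aeval e (AVar 10)))) with (2 * S (aeval e (AVar 10)) + 1) by lia.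
      now rewrite H, enc_nat_succ_double, code_app.
    + now exists [].
    + destruct H0 as (l & _ & E). exists (aeval e (AVar 10) :: l). split; auto.
      now rewrite H, E, map_cons, code_forest_cons.
    + now exists [].
    + destruct H1 as (l & _ & E). exists ((aeval e (AVar 10), aeval e (AVar 14)) :: l).
      split; auto.
      rewrite H, H0, E, map_cons, code_forest_cons. unfold edge_tree at 2.
      now rewrite code_node2.
    + now exists [].
    + destruct H as (l & _ & E1), H0 as (L & EL & E2). exists (l :: L).
      split; [cbn [length]; congruence |].
      rewrite E1, E2, map_cons, code_forest_cons. unfold label_tree at 2.
      now rewrite code_enc_node.
    + exists (LAtom (aeval e (AVar 10))). split; auto. rewrite H. cbn [ltl_tree]. now rewrite code_node1.
  - apply in_map_iff in Hr as (k & <- & Hk). unfold fst, snd in *.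
    apply Forall_inv in Hp. rewrite !parse_set_fact in *. cbn [parses] in *.
    rewrite !aeval_code_term in *. destruct Hp as (f & _ & E). rewrite E, <- code_node1.
    repeat destruct Hk as [<- | Hk]; try contradiction Hk;
      [exists (LNeg f) | exists (LX f) | exists (LF f) | exists (LG f) | exists (LTilde f)];
      auto.
  - apply in_map_iff in Hr as (k & <- & Hk). unfold fst, snd in *.
    apply Forall_cons_iff in Hp as [H1 Hp]. apply Forall_inv in Hp.
    rewrite !parse_set_fact in *. cbn [parses] in *.
    rewrite !aeval_code_term in *. destruct H1 as (f & _ & E1), Hp as (g & _ & E2).
    rewrite E1, E2, <- code_node2.
    repeat destruct Hk as [<- | Hk]; try contradiction Hk;
      [exists (LAnd f g) | exists (LOr f g) | exists (LU f g) | exists (LR f g)]; auto.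
Qed.

Definition rule_env (e1 : nat -> nat) (n x y z m x' : nat) : nat -> nat :=
  fun i => match i with
           | 10 => n | 11 => x | 12 => y | 13 => z | 14 => m | 15 => x' | _ => e1 i
           end.

Lemma rule_env_agrees e1 n x y z m x' i :
  ~ In i rule_vars -> rule_env e1 n x y z m x' i = e1 i.
Proof.
  intros H. unfold rule_vars in H. cbn [In] in H.
  do 16 (destruct i as [| i]; [try reflexivity; tauto |]). reflexivity.
Qed.

(** A derivation is built along the parsed object: numbers by stripping the last binary digit, lists
    and formulas by structural induction. *)
Lemma parse_set_least e1 S : closed_under_rules e1 S ->
  forall tag n x y, parses tag n x y -> S [tag; n; x; y].
Proof.
  intros HS.
  assert (forall k, k < length rules -> forall n x y z m x',
    Forall (fun p => S (map (aeval (rule_env e1 n x y z m x')) p)) (fst (nth k rules ([], []))) ->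
    S (map (aeval (rule_env e1 n x y z m x')) (snd (nth k rules ([], []))))) as H
    by (intros k L *; apply HS; auto using rule_env_agrees, nth_In).
  (* Eleven rules are listed one by one, five come from the unary and four from the binary
     connectives; the last two groups start at positions 11 and 16. *)
  change (length rules) with 20 in H. clear HS.
  assert (forall n x y, parses 0 n x y -> S [0; n; x; y]) as H0.
  { cbn [parses]. intros n x y ->. revert y.
    induction n as [n IH] using (well_founded_induction lt_wf); intros y.
    destruct n as [| [| n]].
    - apply (H 0 ltac:(lia) 0 0 y 0 0 0). constructor.
    - apply (H 1 ltac:(lia) 0 0 y 0 0 0). constructor.
    - destruct (Nat.Even_or_Odd n) as [[m ->] | [m ->]].
      + replace (Datatypes.S (Datatypes.S (2 * m))) with (2 * Datatypes.S m) by lia.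
        rewrite enc_nat_double, code_app.
        assert (S [0; m + 1; code (enc_nat (Datatypes.S m)) (code [D0] y); code [D0] y]) as K
          by (rewrite Nat.add_1_r; apply IH; lia).
        rewrite <- (Nat.add_1_r m) at 1.
        apply (H 2 ltac:(lia) m (code (enc_nat (Datatypes.S m)) (code [D0] y)) y 0 0 0).
        repeat constructor. exact K.
      + replace (Datatypes.S (Datatypes.S (2 * m + 1))) with (2 * Datatypes.S m + 1) by lia.
        rewrite enc_nat_succ_double, code_app.
        assert (S [0; m + 1; code (enc_nat (Datatypes.S m)) (code [D1] y); code [D1] y]) as K
          by (rewrite Nat.add_1_r; apply IH; lia).
        rewrite <- (Nat.add_1_r m) at 1.
        apply (H 3 ltac:(lia) m (code (enc_nat (Datatypes.S m)) (code [D1] y)) y 0 0 0).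
        repeat constructor. exact K. }
  assert (forall n x y, parses 1 n x y -> S [1; n; x; y]) as H1.
  { intros n x y (l & -> & ->). induction l as [| p l IH].
    - apply (H 4 ltac:(lia) 0 0 y 0 0 0). constructor.
    - rewrite map_cons, code_forest_cons.
      apply (H 5 ltac:(lia) p (code (enc_nat p) (code (forest (map Leaf l)) y)) y
               (code (forest (map Leaf l)) y) 0 0).
      constructor; [apply H0; reflexivity | constructor; [exact IH | constructor]]. }
  assert (forall n x y, parses 2 n x y -> S [2; n; x; y]) as H2.
  { intros n x y (l & -> & ->). induction l as [| [v w] l IH].
    - apply (H 6 ltac:(lia) 0 0 y 0 0 0). constructor.
    - rewrite map_cons, code_forest_cons. unfold edge_tree at 1. cbn [fst snd].
      rewrite code_node2.
      set (z := code (forest (map edge_tree l)) y) in *.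
      apply (H 7 ltac:(lia) v (code (enc_nat v) (code [Comma] (code (enc_nat w) (code [RPar] z))))
               y z w (code (enc_nat w) (code [RPar] z))).
      repeat constructor; [apply H0; reflexivity | apply H0; reflexivity | exact IH]. }
  assert (forall n x y, parses 3 n x y -> S [3; n; x; y]) as H3.
  { intros n x y (L & -> & ->). induction L as [| l L IH].
    - apply (H 8 ltac:(lia) 0 0 y 0 0 0). constructor.
    - rewrite map_cons, code_forest_cons. unfold label_tree at 1. rewrite code_enc_node.
      set (z := code (forest (map label_tree L)) y) in *.
      cbn [length]. rewrite <- (Nat.add_1_r (length L)).
      apply (H 9 ltac:(lia) (length L) (code (forest (map Leaf l)) (code [RPar] z)) y z 0 0).
      repeat constructor; [apply H1; now exists l | exact IH]. }
  intros [| [| [| [| [| tag]]]]] n x y; auto; [| contradiction].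
  intros (f & -> & ->). revert y.
  assert (forall k f, k < 5 -> (forall y, S [4; 0; code (enc_tree (ltl_tree f)) y; y]) ->
    forall y, S [4; 0; code (node_start (nth k [1; 4; 5; 6; 9] 0))
                       (code (enc_tree (ltl_tree f)) (code [RPar] y)); y]) as HU.
  { intros k g Hk IH y.
    do 5 (destruct k as [| k]; [match goal with |- context [nth ?k [1; 4; 5; 6; 9]] =>
      apply (H (11 + k) ltac:(lia) 0 (code (enc_tree (ltl_tree g)) (code [RPar] y)) y 0 0 0)
      end; apply Forall_cons; [apply IH | constructor] |]). lia. }
  assert (forall k f g, k < 4 -> (forall y, S [4; 0; code (enc_tree (ltl_tree f)) y; y]) ->
    (forall y, S [4; 0; code (enc_tree (ltl_tree g)) y; y]) ->
    forall y, S [4; 0; code (node_start (nth k [2; 3; 7; 8] 0))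
                       (code (enc_tree (ltl_tree f)) (code [Comma]
                          (code (enc_tree (ltl_tree g)) (code [RPar] y)))); y]) as HB.
  { intros k g h Hk IHg IHh y.
    set (z := code (enc_tree (ltl_tree h)) (code [RPar] y)).
    do 4 (destruct k as [| k]; [match goal with |- context [nth ?k [2; 3; 7; 8]] =>
      apply (H (16 + k) ltac:(lia) 0 (code (enc_tree (ltl_tree g)) (code [Comma] z)) y z 0 0)
      end; apply Forall_cons; [apply IHg | apply Forall_cons; [apply IHh | constructor]] |]). lia. }
  induction f as [p | f IHf | f IHf g IHg | f IHf g IHg | f IHf | f IHf | f IHf
                  | f IHf g IHg | f IHf g IHg | f IHf];
    intros y; cbn [ltl_tree]; rewrite ?code_node1, ?code_node2.
  - apply (H 10 ltac:(lia) p (code (enc_nat p) (code [RPar] y)) y 0 0 0).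
    repeat constructor. apply H0. reflexivity.
  - apply (HU 0); auto; lia.
  - apply (HB 0); auto; lia.
  - apply (HB 1); auto; lia.
  - apply (HU 1); auto; lia.
  - apply (HU 2); auto; lia.
  - apply (HU 3); auto; lia.
  - apply (HB 2); auto; lia.
  - apply (HB 3); auto; lia.
  - apply (HU 4); auto; lia.
Qed.

(** * Defining the model-checking instance and its team *)

Definition parse_formula (tag : nat) (n x y : aterm) : soa := SApp 4 (fact tag n x y).

Definition ex1 (vs : list nat) (f : soa) : soa := fold_right SEx1 f vs.

Definition least_formula : soa :=
  SAnd (rules_formula 4)
    (SAll2 5 4 (Imp (rules_formula 5)
       (all1 rule_vars (let vs := [AVar 10; AVar 11; AVar 12; AVar 13] in
                        Imp (SApp 4 vs) (SApp 5 vs))))).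

Definition reads (e2 : env2) : Prop :=
  forall tag n x y, e2 4 4 [tag; n; x; y] <-> parses tag n x y.

(** Soundness compares the relation with [parse_set], which is closed under the rules; completeness
    follows from closure alone. *)
Lemma ssat_least e1 e2 : ssat e1 e2 least_formula <-> reads e2.
Proof.
  unfold least_formula. cbn [ssat]. setoid_rewrite ssat_Imp.
  setoid_rewrite ssat_rules. setoid_rewrite ssat_all1. setoid_rewrite ssat_Imp.
  split.
  - intros [H HL] tag n x y. split.
    + intros HR.
      (* The quadruple is loaded into variables 10 to 13, where the inclusion is stated. *)
      specialize (HL parse_set (parse_set_closed e1) (rule_env e1 tag n x y 0 0)).
      apply HL; [apply rule_env_agrees | exact HR].
    + apply (parse_set_least e1 (e2 4 4) H).
  - intros HR.
    assert (forall l, length l = 4 -> e2 4 4 l <-> parse_set l) as E.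
    { intros [| tag [| n [| x [| y [| ? ?]]]]] L; try discriminate L. apply HR. }
    split.
    + intros r e Hr He Hp.
      pose proof (rules_arity r Hr) as HA.
      apply E; [rewrite length_map; apply HA; now left |].
      apply (parse_set_closed e1 r e Hr He).
      rewrite Forall_forall in *. intros p Ip. apply E, Hp, Ip.
      rewrite length_map. apply HA. now right.
    + intros S HS e He HP. apply (parse_set_least e1 S HS). now apply HR in HP.
Qed.

Lemma ssat_parse e1 e2 tag n x y : reads e2 ->
  ssat e1 e2 (parse_formula tag n x y) <-> parses tag (aeval e1 n) (aeval e1 x) (aeval e1 y).
Proof.
  intros HR. unfold parse_formula, fact. cbn [ssat map length].
  rewrite aeval_numeral. apply HR.
Qed.

(* The number variable 0 is the code of the instance, 20 and 21 are the number of
   worlds and the root; 22 to 26 are suffixes of the input: from the number of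
   worlds, the edges, the labels, the root and the LTL formula on. *)
Definition layout (K : kripke) (f : ltl) (e : nat -> nat) : Prop :=
  (e 20 = kw_n K /\ e 21 = kw_root K) /\
  e 0 = code (node_start 0 ++ node_start 0) (e 22) /\
  e 22 = code (enc_nat (kw_n K)) (code [Comma; LPar; D0] (e 23)) /\
  e 23 = code (forest (map edge_tree (kw_edges K))) (code [RPar; Comma; LPar; D0] (e 24)) /\
  e 24 = code (forest (map label_tree (kw_lab K))) (code [RPar; Comma] (e 25)) /\
  e 25 = code (enc_nat (kw_root K)) (code [RPar; Comma] (e 26)) /\
  e 26 = code (enc_tree (ltl_tree f)) (code [RPar] 0).

Definition layout_formula : soa :=
  conj [SEq (AVar 0) (code_term (node_start 0 ++ node_start 0) (AVar 22));
        parse_formula 0 (AVar 20) (AVar 22) (code_term [Comma; LPar; D0] (AVar 23));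
        parse_formula 2 AZero (AVar 23) (code_term [RPar; Comma; LPar; D0] (AVar 24));
        parse_formula 3 (AVar 20) (AVar 24) (code_term [RPar; Comma] (AVar 25));
        parse_formula 0 (AVar 21) (AVar 25) (code_term [RPar; Comma] (AVar 26));
        parse_formula 4 AZero (AVar 26) (code_term [RPar] AZero)].

Lemma code_instance K f e : layout K f e -> e 0 = code (enc_instance K f) 0.
Proof.
  intros (_ & E0 & E2 & E3 & E4 & E5 & E6).
  rewrite enc_instance_tree. unfold instance_tree, kripke_tree.
  rewrite code_node2, code_enc_node, !code_forest_cons, !code_enc_node.
  rewrite E0, code_app, E2, E3, E4, E5, E6, !code_node_start, <- !code_app.
  f_equal. change (enc_nat 0) with [D0]. cbn [enc_tree forest flat_map].
  rewrite <- !app_assoc. reflexivity.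
Qed.

(** The count carried by the facts of kind 3 equals variable 20, which forces as many labels as
    worlds. *)
Lemma ssat_layout e1 e2 : reads e2 ->
  ssat e1 e2 layout_formula <->
  exists K f, length (kw_lab K) = kw_n K /\ layout K f e1.
Proof.
  intros HR. unfold layout_formula, conj. cbn [fold_right ssat].
  rewrite !(fun tag n x y => ssat_parse e1 e2 tag n x y HR), !aeval_code_term.
  cbn [parses aeval ttrue ssat]. split.
  - intros (E0 & E2 & (l & _ & E3) & (L & EL & E4) & E5 & (f & _ & E6) & _).
    exists {| kw_n := e1 20; kw_edges := l; kw_lab := L; kw_root := e1 21 |}, f.
    unfold layout. cbn [kw_n kw_lab kw_edges kw_root]. repeat split; auto.
  - intros (K & f & HL & (-> & ->) & E0 & E2 & E3 & E4 & E5 & E6).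
    repeat split; eauto.
Qed.

(* Variables 43 and 44 are the source and the target of the edge. *)
Definition edge_formula : soa :=
  ex1 [30; 31; 32] (conj
    [parse_formula 2 AZero (AVar 23) (code_term (Comma :: node_start 0) (AVar 30));
     parse_formula 0 (AVar 43) (AVar 30) (code_term [Comma] (AVar 31));
     parse_formula 0 (AVar 44) (AVar 31) (code_term [RPar] (AVar 32));
     parse_formula 2 AZero (AVar 32) (code_term [RPar; Comma; LPar; D0] (AVar 24))]).

(* Variable 43 is the world and 45 the atom. *)
Definition label_formula : soa :=
  ex1 [30; 31; 32; 33; 34] (conj
    [parse_formula 3 (AVar 43) (AVar 24) (code_term [Comma; LPar; D0] (AVar 30));
     parse_formula 1 AZero (AVar 30) (code_term [Comma] (AVar 31));
     parse_formula 0 (AVar 45) (AVar 31) (AVar 32);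
     parse_formula 1 AZero (AVar 32) (code_term [RPar] (AVar 33));
     parse_formula 3 (AVar 34) (AVar 33) (code_term [RPar; Comma] (AVar 25))]).

Lemma forest_app cs cs' : forest (cs ++ cs') = forest cs ++ forest cs'.
Proof. apply flat_map_app. Qed.

(** The formula cuts the input at one edge; unique readability turns this cut of a number into a cut
    of the edge list. *)
Lemma ssat_edge K f e1 e2 : reads e2 -> layout K f e1 ->
  ssat e1 e2 edge_formula <-> In (e1 43, e1 44) (kw_edges K).
Proof.
  intros HR HL. unfold edge_formula, conj, ex1. cbn [fold_right ssat].
  setoid_rewrite (fun e tag n x y => ssat_parse e e2 tag n x y HR).
  setoid_rewrite aeval_code_term. cbn [parses aeval ttrue ssat upd1 Nat.eqb].
  destruct HL as (_ & _ & _ & E3 & _).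
  split.
  - intros (x & y & z & (l & _ & H1) & H2 & H3 & (l' & _ & H4) & _).
    rewrite E3, H2, H3, H4 in H1.
    assert (kw_edges K = l ++ (e1 43, e1 44) :: l') as ->; [| apply in_elt].
    apply (map_inj edge_tree edge_tree_inj).
    (* The [RPar] that opens the separator serves as the end marker of the forest. *)
    apply (forest_code_inj _ _ (code [Comma; LPar; D0] (e1 24))
             (code [Comma; LPar; D0] (e1 24))).
    refine (eq_trans H1 _). rewrite map_app, map_cons, forest_app, code_app, code_forest_cons.
    unfold edge_tree at 4. now rewrite code_node2.
  - intros H. apply in_split in H as (l & l' & E). rewrite E in E3.
    exists (code (enc_nat (e1 43)) (code [Comma] (code (enc_nat (e1 44)) (code [RPar]
              (code (forest (map edge_tree l')) (code [RPar; Comma; LPar; D0] (e1 24))))))).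
    exists (code (enc_nat (e1 44)) (code [RPar]
              (code (forest (map edge_tree l')) (code [RPar; Comma; LPar; D0] (e1 24))))).
    exists (code (forest (map edge_tree l')) (code [RPar; Comma; LPar; D0] (e1 24))).
    repeat split; eauto. exists l. split; auto.
    rewrite E3, map_app, map_cons, forest_app, code_app, code_forest_cons.
    unfold edge_tree at 2. now rewrite code_node2.
Qed.

(** A world is identified by the number of labels preceding its own, which is why the facts of kind
    3 count their items. *)
Lemma ssat_label K f e1 e2 : reads e2 -> layout K f e1 ->
  ssat e1 e2 label_formula <-> label K (e1 43) (e1 45) = true.
Proof.
  intros HR HL. unfold label_formula, conj, ex1. cbn [fold_right ssat].
  setoid_rewrite (fun e tag n x y => ssat_parse e e2 tag n x y HR).
  setoid_rewrite aeval_code_term. cbn [parses aeval ttrue ssat upd1 Nat.eqb].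
  destruct HL as (_ & _ & _ & _ & E4 & _).
  assert (label K (e1 43) (e1 45) = true <-> In (e1 45) (nth (e1 43) (kw_lab K) [])) as ->.
  { unfold label. rewrite existsb_exists. split.
    - intros (p & Hp & E). apply Nat.eqb_eq in E as ->. exact Hp.
    - intros H. exists (e1 45). auto using Nat.eqb_refl. }
  split.
  - intros (x & y & z & u & k & (L & EL & H1) & (l & _ & H2) & H3 & (l' & _ & H4) & (L' & _ & H5) & _).
    rewrite E4, H2, H3, H4, H5 in H1.
    assert (kw_lab K = L ++ (l ++ e1 45 :: l') :: L') as ->
      by (apply (map_inj label_tree label_tree_inj),
            (forest_code_inj _ _ (code [Comma] (e1 25)) (code [Comma] (e1 25)));
          refine (eq_trans H1 _);
          rewrite map_app, map_cons, forest_app, code_app, code_forest_cons;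
          unfold label_tree at 4;
          now rewrite code_enc_node, map_app, forest_app, code_app, map_cons, code_forest_cons).
    rewrite EL, nth_middle. apply in_elt.
  - intros H.
    (* Outside this range the default label is empty and contains no atom. *)
    assert (e1 43 < length (kw_lab K)) as Hlt.
    { destruct (Nat.lt_ge_cases (e1 43) (length (kw_lab K))) as [Hlt | Hge]; auto.
      rewrite nth_overflow in H by auto. destruct H. }
    destruct (nth_split (kw_lab K) [] Hlt) as (L & L' & E & EL).
    apply in_split in H as (l & l' & El). rewrite El in E. rewrite E in E4.
    set (x5 := code (forest (map label_tree L')) (code [RPar; Comma] (e1 25))).
    set (x4 := code (forest (map Leaf l')) (code [RPar] x5)).
    exists (code (forest (map Leaf l)) (code [Comma] (code (enc_nat (e1 45)) x4))).
    exists (code (enc_nat (e1 45)) x4), x4, x5, (length L').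
    split; [exists L; split; auto | repeat split; [exists l | exists l' | exists L']; auto].
    rewrite E4, map_app, map_cons, forest_app, code_app, code_forest_cons.
    unfold label_tree at 2.
    now rewrite code_enc_node, map_app, forest_app, code_app, map_cons, code_forest_cons.
Qed.

(** * Well-formedness and the enumerated team *)

Definition Lt (s t : aterm) : soa := SLe (APlus s AOne) t.

Definition wf_formula : soa :=
  conj [Lt (AVar 21) (AVar 20);
        SAll1 43 (SAll1 44 (Imp edge_formula
          (SAnd (Lt (AVar 43) (AVar 20)) (Lt (AVar 44) (AVar 20)))));
        SAll1 43 (Imp (Lt (AVar 43) (AVar 20)) (SEx1 44 edge_formula))].

(* The set variable 6 is the trace, as a binary relation. *)
Definition defines_class (cf : soa) (C : trace -> Prop) : Prop :=
  forall e1 e2 t, (forall i p, e2 6 2 [i; p] <-> t i p = true) ->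
    ssat e1 e2 cf <-> C t.

(* The set variable 7 is the path; it need not be functional, since any choice of
   worlds from it is a path. *)
Definition trace_formula (cf : soa) : soa :=
  SEx2 7 2 (conj
    [SAll1 46 (SEx1 43 (SApp 7 [AVar 46; AVar 43]));
     SAll1 43 (Imp (SApp 7 [AZero; AVar 43]) (SEq (AVar 43) (AVar 21)));
     SAll1 46 (SAll1 43 (SAll1 44 (Imp (SApp 7 [AVar 46; AVar 43])
       (Imp (SApp 7 [APlus (AVar 46) AOne; AVar 44]) edge_formula))));
     SAll1 46 (SAll1 43 (SAll1 45 (Imp (SApp 7 [AVar 46; AVar 43])
       (Iff (SApp 6 [AVar 46; AVar 45]) label_formula))));
     cf]).

(** Traces are binary relations, so relation 6 runs through all of them, and both inclusions between
    the team and the enumerated set are asserted. *)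
Definition enumeration_formula (cf : soa) : soa :=
  SAll2 6 2 (Iff (trace_formula cf)
    (SEx1 60 (SAnd (SApp 1 [AVar 60])
      (SAll1 61 (SAll1 62 (Iff (SApp 0 [AVar 60; AVar 61; AVar 62])
                               (SApp 6 [AVar 61; AVar 62]))))))).

Definition instance_formula (cf : soa) : soa :=
  SEx2 4 4 (SAnd least_formula (ex1 [20; 21; 22; 23; 24; 25; 26]
    (conj [layout_formula; wf_formula; enumeration_formula cf]))).

(** Positivity of the number of worlds comes from the bound on the root, and the length of the label
    list from the layout. *)
Lemma ssat_wf K f e1 e2 : reads e2 -> layout K f e1 -> length (kw_lab K) = kw_n K ->
  ssat e1 e2 wf_formula <-> kripke_wf K.
Proof.
  intros HR HL HN. unfold wf_formula, conj, kripke_wf. cbn [fold_right ssat].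
  setoid_rewrite ssat_Imp.
  assert (forall e, (forall i, i < 30 -> e i = e1 i) -> layout K f e) as HL'.
  { intros e He. unfold layout in *. rewrite !He by lia. exact HL. }
  pose proof HL as ((E20 & E21) & _).
  assert (forall v w, ssat (upd1 (upd1 e1 43 v) 44 w) e2 edge_formula <->
                      In (v, w) (kw_edges K)) as HE.
  { intros v w. rewrite (ssat_edge K f); [reflexivity | exact HR |].
    apply HL'. intros i Hi. unfold upd1.
    destruct (Nat.eqb_spec i 44), (Nat.eqb_spec i 43); lia. }
  cbn [ssat]. setoid_rewrite HE.
  unfold Lt. cbn [ssat aeval upd1 Nat.eqb ttrue]. rewrite E20, E21.
  setoid_rewrite Nat.add_1_r. unfold lt. intuition lia.
Qed.

Lemma ssat_trace cf C K f e1 e2 : defines_class cf C ->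
  reads e2 -> layout K f e1 ->
  ssat e1 e2 (trace_formula cf) <->
  exists t, (forall i p, e2 6 2 [i; p] <-> t i p = true) /\ teamK K t /\ C t.
Proof.
  intros HC HR HL. unfold trace_formula, conj. cbn [fold_right ssat].
  setoid_rewrite ssat_Imp. setoid_rewrite ssat_Imp. setoid_rewrite ssat_Iff.
  assert (forall e, (forall i, i < 30 -> e i = e1 i) -> layout K f e) as HL'.
  { intros e He. unfold layout in *. rewrite !He by lia. exact HL. }
  pose proof HL as ((_ & E21) & _).
  assert (forall S, reads (upd2 e2 7 2 S)) as HR' by (intros S; exact HR).
  assert (forall i v w S, ssat (upd1 (upd1 (upd1 e1 46 i) 43 v) 44 w) (upd2 e2 7 2 S)
            edge_formula <-> In (v, w) (kw_edges K)) as HE.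
  { intros i v w S. rewrite (ssat_edge K f); [reflexivity | apply HR' |].
    apply HL'. intros j Hj. unfold upd1.
    destruct (Nat.eqb_spec j 44), (Nat.eqb_spec j 43), (Nat.eqb_spec j 46); lia. }
  assert (forall i v p S, ssat (upd1 (upd1 (upd1 e1 46 i) 43 v) 45 p) (upd2 e2 7 2 S)
            label_formula <-> label K v p = true) as HB.
  { intros i v p S. rewrite (ssat_label K f); [reflexivity | apply HR' |].
    apply HL'. intros j Hj. unfold upd1.
    destruct (Nat.eqb_spec j 45), (Nat.eqb_spec j 43), (Nat.eqb_spec j 46); lia. }
  cbn [ssat]. setoid_rewrite HE. setoid_rewrite HB.
  cbn -[label]. rewrite E21. setoid_rewrite Nat.add_1_r. split.
  - intros (S & H1 & H2 & H3 & H4 & H5 & _).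
    (* One world per time is chosen from the relation; all choices carry the same labels, namely
       those of the trace. *)
    set (pi := fun i => proj1_sig (constructive_indefinite_description _ (H1 i))).
    assert (forall i, S [i; pi i]) as Hpi
      by (intros i; apply (proj2_sig (constructive_indefinite_description _ (H1 i)))).
    assert (forall i p, e2 6 2 [i; p] <-> label K (pi i) p = true) as Ht
      by (intros i p; apply H4, Hpi).
    exists (fun i p => label K (pi i) p). split; [exact Ht |]. split.
    + exists pi. split; [split |]; auto. intros i. apply (H3 i); auto.
    + now apply (HC e1 (upd2 e2 7 2 S)).
  - intros (t & Ht & (pi & [P0 PS] & Hpi) & HCt).
    exists (fun l => match l with [i; v] => v = pi i | _ => False end). repeat split.
    + intros i. now exists (pi i).
    + intros v ->. exact P0.
    + intros i v w -> ->. apply PS.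
    + subst. intros HT. rewrite <- Hpi. now apply Ht.
    + subst. intros HT. apply Ht. now rewrite Hpi.
    + now apply (HC _ _ t).
Qed.

Lemma ssat_enumeration cf C K f e1 e2 e : defines_class cf C ->
  reads e2 -> layout K f e1 -> enumerates e2 e ->
  ssat e1 e2 (enumeration_formula cf) <->
  forall t, team_inter (teamK K) C t <-> indexed_team e 0 (set1 e2) t.
Proof.
  intros HC HR HL He. unfold enumeration_formula. cbn [ssat]. setoid_rewrite ssat_Iff.
  assert (forall t, indexed_team e 0 (set1 e2) t <->
                    exists n, e2 1 1 [n] /\ forall i p, e n i p = t i p) as HT.
  { intros t. unfold indexed_team, set1. split; intros (n & Hn & E); exists n; split; auto.
    - intros i p. rewrite E. unfold tsuffix. now rewrite Nat.add_0_r.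
    - apply trace_ext. intros i p. unfold tsuffix. now rewrite Nat.add_0_r, E. }
  assert (forall S, reads (upd2 e2 6 2 S)) as HR' by (intros S; exact HR).
  assert (forall S, ssat e1 (upd2 e2 6 2 S) (trace_formula cf) <->
    exists t, (forall i p, S [i; p] <-> t i p = true) /\ teamK K t /\ C t) as HS
    by (intros S; exact (ssat_trace cf C K f e1 (upd2 e2 6 2 S) HC (HR' S) HL)).
  setoid_rewrite HS. cbn [ssat]. setoid_rewrite ssat_Iff. cbn. split.
  - intros H t. rewrite HT.
    specialize (H (fun l => match l with [i; p] => t i p = true | _ => False end)).
    cbn in H. unfold team_inter. split.
    + intros [Kt Ct]. destruct (proj1 H) as (n & Hn & E); [exists t; tauto |].
      exists n. split; auto. intros i p. apply eq_true_iff_eq.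
      rewrite <- E. symmetry. apply He.
    + intros (n & Hn & E). destruct (proj2 H) as (u & Hu & HK & HCu).
      { exists n. split; auto. intros i p. rewrite <- E. apply He. }
      assert (u = t) as <-; auto.
      apply trace_ext. intros i p. apply eq_true_iff_eq. symmetry. apply Hu.
  - intros H S. split.
    + intros (t & Ht & HK & HCt). destruct (proj1 (HT t)) as (n & Hn & E); [now apply H |].
      exists n. split; auto. intros i p. rewrite Ht, <- E. apply He.
    + intros (n & Hn & E). exists (e n). split.
      * intros i p. rewrite <- E. apply He.
      * apply H, HT. now exists n.
Qed.

Lemma layout_exists K f x0 : x0 = code (enc_instance K f) 0 ->
  exists x2 x3 x4 x5 x6, layout K f
    (fun i => match i with
              | 0 => x0 | 20 => kw_n K | 21 => kw_root K
              | 22 => x2 | 23 => x3 | 24 => x4 | 25 => x5 | 26 => x6 | _ => 0 end).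
Proof.
  intros ->.
  (* The suffixes are introduced from the end of the word backwards, each known only through an
     equation. *)
  destruct (ex_intro (fun x => x = code (enc_tree (ltl_tree f)) (code [RPar] 0)) _ eq_refl)
    as [x6 E6].
  destruct (ex_intro (fun x => x = code (enc_nat (kw_root K)) (code [RPar; Comma] x6)) _ eq_refl)
    as [x5 E5].
  destruct (ex_intro (fun x => x = code (forest (map label_tree (kw_lab K)))
              (code [RPar; Comma] x5)) _ eq_refl) as [x4 E4].
  destruct (ex_intro (fun x => x = code (forest (map edge_tree (kw_edges K)))
              (code [RPar; Comma; LPar; D0] x4)) _ eq_refl) as [x3 E3].
  destruct (ex_intro (fun x => x = code (enc_nat (kw_n K)) (code [Comma; LPar; D0] x3)) _ eq_refl)
    as [x2 E2].
  exists x2, x3, x4, x5, x6.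
  pose (env x0 i := match i with
              | 0 => x0 | 20 => kw_n K | 21 => kw_root K
              | 22 => x2 | 23 => x3 | 24 => x4 | 25 => x5 | 26 => x6 | _ => 0 end).
  assert (layout K f (env (code (node_start 0 ++ node_start 0) x2))) as HL
    by (repeat split; assumption).
  pose proof (code_instance K f _ HL) as E. unfold env at 1 in E.
  rewrite <- E. exact HL.
Qed.

Lemma ssat_instance cf C e1 e2 e : defines_class cf C -> enumerates e2 e ->
  ssat e1 e2 (instance_formula cf) <->
  exists K f, e1 0 = code (enc_instance K f) 0 /\ kripke_wf K /\
    forall t, team_inter (teamK K) C t <-> indexed_team e 0 (set1 e2) t.
Proof.
  intros HC He. unfold instance_formula, ex1. cbn [ssat fold_right]. split.
  - intros (R & HR & n & r & x2 & x3 & x4 & x5 & x6 & H).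
    rewrite ssat_least in HR. unfold conj in H. cbn [fold_right ssat] in H.
    destruct H as (H1 & H2 & H3 & _). apply (ssat_layout _ _ HR) in H1 as (K & f & HN & HL).
    exists K, f. split; [exact (code_instance K f _ HL) |].
    apply (ssat_wf K f _ _ HR HL HN) in H2. split; auto.
    exact (proj1 (ssat_enumeration cf C K f _ (upd2 e2 4 4 R) e HC HR HL He) H3).
  - intros (K & f & E & HK & HT).
    exists parse_set.
    assert (reads (upd2 e2 4 4 parse_set)) as HR by (intros tag n x y; reflexivity).
    split; [now apply ssat_least |].
    destruct (layout_exists K f (e1 0) E) as (x2 & x3 & x4 & x5 & x6 & HL').
    exists (kw_n K), (kw_root K), x2, x3, x4, x5, x6.
    match goal with |- ssat ?e1' _ _ => assert (layout K f e1') as HL by exact HL' end.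
    clear HL'.
    assert (length (kw_lab K) = kw_n K) as HN by apply HK.
    unfold conj. cbn [fold_right ssat]. split; [| split; [| split; [| reflexivity]]].
    + apply (ssat_layout _ _ HR). exists K, f. split; assumption.
    + now apply (ssat_wf K f _ _ HR HL HN).
    + exact (proj2 (ssat_enumeration cf C K f _ (upd2 e2 4 4 parse_set) e HC HR HL He) HT).
Qed.

Lemma closed_instance cf b1 b2 :
  (forall b1 b2, existsb (fun '(Y, m) => Nat.eqb 6 Y && Nat.eqb 2 m) b2 = true ->
     sclosed b1 b2 cf = true) ->
  existsb (Nat.eqb 0) b1 = true ->
  existsb (fun '(Y, m) => Nat.eqb 0 Y && Nat.eqb 3 m) b2 = true ->
  existsb (fun '(Y, m) => Nat.eqb 1 Y && Nat.eqb 1 m) b2 = true ->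
  sclosed b1 b2 (instance_formula cf) = true.
Proof.
  intros H H0 H1 H2. cbn in H0, H1, H2. cbn.
  rewrite H0, H1, H2, H; reflexivity.
Qed.

(** * Countability of the ultimately periodic traces of a structure *)

Definition lasso_trace (K : kripke) (c d : nat) (ws : list nat) : trace :=
  fun i => label K (nth (if i <? c then i else c + (i - c) mod d) ws 0).

(** The path itself need not be ultimately periodic. Its first [c + d] worlds are kept, and the
    periodicity of the trace repeats their labels, even if the repeated worlds do not form a
    path. *)
Lemma ult_periodic_lasso K t : teamK K t -> ult_periodic t ->
  exists c d ws, t = lasso_trace K c d ws.
Proof.
  intros (pi & _ & Hpi) (c & d & _ & Hd & HP).
  exists c, d, (map pi (seq 0 (c + d))). apply trace_ext. intros i p. unfold lasso_trace.
  assert (forall j, j < c + d -> nth j (map pi (seq 0 (c + d))) 0 = pi j) as HN.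
  { intros j Hj. rewrite (nth_indep _ 0 (pi 0)) by (now rewrite length_map, length_seq).
    now rewrite map_nth, seq_nth. }
  destruct (Nat.ltb_spec i c) as [L | L].
  - rewrite HN by lia. apply Hpi.
  - pose proof (Nat.mod_upper_bound (i - c) d ltac:(lia)).
    rewrite HN, <- Hpi by lia.
    assert (forall q s, t (c + s + q * d) p = t (c + s) p) as HQ.
    { intros q s. induction q as [| q IH]; [f_equal; lia |].
      rewrite <- IH, (HP (c + s + q * d)) by lia. f_equal. lia. }
    rewrite <- (HQ ((i - c) / d)). f_equal.
    pose proof (Nat.div_mod_eq (i - c) d). lia.
Qed.

(** The data of a lasso are coded injectively by a number; the enumeration inverts this code and is
    arbitrary on numbers that code nothing. *)
Lemma lasso_traces_countable K :
  exists e : nat -> trace, forall c d ws, exists n, e n = lasso_trace K c d ws.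
Proof.
  pose (index := fun c d ws => code (forest (map Leaf (c :: d :: ws))) (code [RPar] 0)).
  assert (forall c d ws c' d' ws', index c d ws = index c' d' ws' ->
            c = c' /\ d = d' /\ ws = ws') as HI.
  { intros * E. apply forest_code_inj in E as [E _].
    apply map_inj in E; [| congruence]. injection E. auto. }
  pose (P := fun n t => exists c d ws, n = index c d ws /\ t = lasso_trace K c d ws).
  exists (fun n => epsilon (inhabits (fun _ _ => false)) (P n)).
  intros c d ws. exists (index c d ws).
  destruct (epsilon_spec (inhabits (fun _ _ => false)) (P (index c d ws)))
    as (c' & d' & ws' & E & ->).
  - now exists (lasso_trace K c d ws), c, d, ws.
  - apply HI in E as (-> & -> & ->). reflexivity.
Qed.

(** The enumeration may contain lassos outside the team; the index set selects the members, and it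
    is empty when the team is. *)
Lemma team_countable K C : (forall t, C t -> ult_periodic t) ->
  exists (e : nat -> trace) (X : nat -> Prop),
    forall t, team_inter (teamK K) C t <-> indexed_team e 0 X t.
Proof.
  intros HC. destruct (lasso_traces_countable K) as [e He].
  exists e, (fun n => team_inter (teamK K) C (e n)). intros t.
  assert (forall n, tsuffix (e n) 0 = e n) as E
    by (intros n; apply trace_ext; intros i p; unfold tsuffix; now rewrite Nat.add_0_r).
  split.
  - intros HT. destruct (ult_periodic_lasso K t) as (c & d & ws & ->); [apply HT | |].
    + apply HC, HT.
    + destruct (He c d ws) as [n Hn]. exists n. rewrite E, Hn. auto.
  - intros (n & Hn & ->). now rewrite E.
Qed.

(** * The transducer *)

(* Each visit of a cell emits a whole word; the work tape is not used. The bits of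
   [Index] are the last four digits of the index of a node of the LTL formula. *)
Inductive state : Type :=
| Start | TermOpen | TermClose | Head | Skip0 | Skip1 | Skip2 | Skip3
| Main | Index (b3 b2 b1 b0 : bool) | AtomOpen | AtomBack | AtomClose | Halt.

Definition index_entry (k : nat) : state * list tok :=
  match k with
  | 0 => (AtomOpen, atom_opener)
  | 1 | 4 | 5 | 6 | 9 => (Main, enc_frames (unary_frames k))
  | 2 | 3 | 7 | 8 => (Main, binary_prefix k)
  | _ => (Halt, [])
  end.

Definition bits_val (b3 b2 b1 b0 : bool) : nat :=
  8 * Nat.b2n b3 + 4 * Nat.b2n b2 + 2 * Nat.b2n b1 + Nat.b2n b0.

(** The words [pre] and [mid] surround the code of the input. The skip states record the number of
    open parentheses inside the structure, whose own closing leads back to [Skip0]. *)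
Definition transition (pre mid : list tok) (q : state) (c : cell) :
    state * move * list tok :=
  let silent q' := (q', MRight, []) in
  match q with
  | Start => (TermOpen, MRight, pre)
  | TermOpen =>
      match c with
      | Sym a => (TermOpen, MRight, code_opener a)
      | _ => (TermClose, MLeft, enc_aterm AZero)
      end
  | TermClose =>
      match c with
      | Sym _ => (TermClose, MLeft, [RPar; RPar])
      | _ => (Head, MRight, mid)
      end
  | Head => silent match c with Sym Comma => Skip0 | Sym _ => Head | _ => Halt end
  | Skip0 => silent match c with Sym LPar => Skip1 | Sym Comma => Main | _ => Halt end
  | Skip1 =>
      silent match c with
             | Sym LPar => Skip2 | Sym RPar => Skip0 | Sym _ => Skip1 | _ => Halt
             end
  | Skip2 =>
      silent match c with
             | Sym LPar => Skip3 | Sym RPar => Skip1 | Sym _ => Skip2 | _ => Halt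
             end
  | Skip3 =>
      silent match c with
             | Sym LPar => Halt | Sym RPar => Skip2 | Sym _ => Skip3 | _ => Halt
             end
  | Main =>
      match c with
      | Sym LPar => silent (Index false false false false)
      | Sym Comma => (Main, MRight, binary_middle)
      | Sym RPar => (Main, MRight, repeat RPar 9)
      | _ => silent Halt
      end
  | Index b3 b2 b1 b0 =>
      match c with
      | Sym D0 => silent (Index b2 b1 b0 false)
      | Sym D1 => silent (Index b2 b1 b0 true)
      | Sym Comma => let '(q', u) := index_entry (bits_val b3 b2 b1 b0) in (q', MRight, u)
      | _ => silent Halt
      end
  | AtomOpen =>
      match c with
      | Sym D0 | Sym D1 => (AtomOpen, MRight, binary_opener)
      | _ => (AtomBack, MLeft, enc_aterm AZero)
      end
  | AtomBack =>
      match c with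
      | Sym D0 | Sym D1 => (AtomBack, MLeft, [])
      | _ => silent AtomClose
      end
  | AtomClose =>
      match c with
      | Sym D0 => (AtomClose, MRight, binary_closer D0)
      | Sym D1 => (AtomClose, MRight, binary_closer D1)
      | Sym RPar => (Main, MRight, repeat RPar 4)
      | _ => silent Halt
      end
  | Halt => silent Halt
  end.

Definition mconfig : Type := (state * nat * list tok)%type.

Inductive reach (pre mid w : list tok) : mconfig -> mconfig -> Prop :=
| reach_refl c : reach pre mid w c c
| reach_step q h o q' m u c :
    q <> Halt -> transition pre mid q (read_in w h) = (q', m, u) ->
    reach pre mid w (q', mv_in w h m, o ++ u) c ->
    reach pre mid w (q, h, o) c.

Lemma reach_trans pre mid w c1 c2 c3 :
  reach pre mid w c1 c2 -> reach pre mid w c2 c3 -> reach pre mid w c1 c3.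
Proof. induction 1; eauto using reach_step. Qed.

(** * Simulation by a Turing machine *)

Definition bools : list bool := [false; true].

Definition states : list state :=
  [Start; TermOpen; TermClose; Head; Skip0; Skip1; Skip2; Skip3; Main;
   AtomOpen; AtomBack; AtomClose; Halt] ++
  flat_map (fun b3 => flat_map (fun b2 => flat_map (fun b1 =>
    map (Index b3 b2 b1) bools) bools) bools) bools.

Definition state_index (q : state) : nat :=
  match q with
  | Start => 0 | TermOpen => 1 | TermClose => 2 | Head => 3 | Skip0 => 4 | Skip1 => 5
  | Skip2 => 6 | Skip3 => 7 | Main => 8 | AtomOpen => 9 | AtomBack => 10
  | AtomClose => 11 | Halt => 12 | Index b3 b2 b1 b0 => 13 + bits_val b3 b2 b1 b0
  end.

Lemma nth_state_index q : nth (state_index q) states Halt = q.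
Proof. destruct q as [| | | | | | | | | [] [] [] [] | | | |]; reflexivity. Qed.

Lemma state_index_lt q : state_index q < 29.
Proof. destruct q as [| | | | | | | | | [] [] [] [] | | | |]; cbn; lia. Qed.

Definition cells : list cell :=
  [LEnd; REnd; Sym D0; Sym D1; Sym Comma; Sym LPar; Sym RPar].

(** Emission is letter by letter with the position kept in the machine state, so finiteness of the
    state set requires this bound. *)
Definition max_output (pre mid : list tok) : nat :=
  list_max (map (fun '(q, c) => length (snd (transition pre mid q c))) (list_prod states cells)).

Lemma output_le pre mid q c q' m u :
  transition pre mid q c = (q', m, u) -> length u <= max_output pre mid.
Proof.
  intros H.
  assert (forall l n, In n l -> n <= list_max l) as HM.
  { intros l n Hn. pose proof (proj1 (list_max_le l (list_max l)) (le_n _)) as F.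
    rewrite Forall_forall in F. auto. }
  apply HM. apply in_map_iff. exists (q, c). rewrite H. split; auto.
  apply in_prod.
  - rewrite <- (nth_state_index q). apply nth_In, state_index_lt.
  - destruct c as [| [] |]; cbn; auto 10.
Qed.

(* The machine state [index + 29 * i] has emitted [i] letters of the current word. *)
Definition machine (pre mid : list tok) : TM :=
  {| tm_nst := 29 * S (max_output pre mid);
     tm_nwk := 1;
     tm_start := state_index Start;
     tm_halt := state_index Halt;
     tm_delta := fun s c _ =>
       let '(q', m, u) := transition pre mid (nth (s mod 29) states Halt) c in
       match nth_error u (s / 29) with
       | Some a => (s + 29, MStay, 0, MStay, Some a)
       | None => (state_index q', m, 0, MStay, None)
       end |}.

Lemma machine_wf pre mid : tm_wf (machine pre mid).
Proof.
  unfold tm_wf. cbn [tm_start tm_halt tm_nst tm_nwk tm_delta machine].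
  pose proof (state_index_lt Start). pose proof (state_index_lt Halt).
  repeat split; try lia.
  intros s c x Hs _.
  destruct (transition pre mid (nth (s mod 29) states Halt) c) as [[q' m] u] eqn:E.
  apply output_le in E. pose proof (state_index_lt q').
  destruct (nth_error u (s / 29)) eqn:Hu; [| lia].
  assert (s / 29 < length u) by (apply nth_error_Some; congruence).
  pose proof (Nat.div_mod_eq s 29). pose proof (Nat.mod_upper_bound s 29 ltac:(lia)). lia.
Qed.

Lemma machine_work_head pre mid w k : c_wh (tm_run (machine pre mid) w k) = 0.
Proof.
  induction k as [| k IH]; [reflexivity |]. cbn [tm_run]. unfold tm_step.
  destruct (Nat.eqb _ _); auto. cbn [tm_delta machine].
  destruct (transition _ _ _ _) as [[q' m] u]. destruct (nth_error _ _); cbn; exact IH.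
Qed.

Definition machine_at (pre mid w : list tok) (k s h : nat) (o : list tok) : Prop :=
  let c := tm_run (machine pre mid) w k in c_st c = s /\ c_ih c = h /\ c_out c = o.

Lemma machine_step pre mid w k q i h o q' m u :
  q <> Halt -> transition pre mid q (read_in w h) = (q', m, u) ->
  machine_at pre mid w k (state_index q + 29 * i) h o ->
  match nth_error u i with
  | Some a => machine_at pre mid w (S k) (state_index q + 29 * S i) h (o ++ [a])
  | None => machine_at pre mid w (S k) (state_index q') (mv_in w h m) o
  end.
Proof.
  intros Hq HT (Hs & Hh & Ho).
  (* For positive [i] the state is at least 29, hence beyond the halting state. *)
  assert (state_index q + 29 * i <> state_index Halt) as HN.
  { intros E. pose proof (state_index_lt Halt).
    assert (state_index q = state_index Halt) as E' by lia.
    apply Hq. now rewrite <- (nth_state_index q), E', nth_state_index. }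
  pose proof (state_index_lt q).
  assert ((state_index q + 29 * i) mod 29 = state_index q) as E1
    by (rewrite Nat.mul_comm, Nat.Div0.mod_add; now apply Nat.mod_small).
  assert ((state_index q + 29 * i) / 29 = i) as E2
    by (rewrite Nat.mul_comm, Nat.div_add by lia; now rewrite Nat.div_small).
  unfold machine_at. cbn [tm_run]. unfold tm_step. rewrite Hs.
  change (tm_halt (machine pre mid)) with (state_index Halt).
  apply Nat.eqb_neq in HN as ->. cbn [tm_delta machine].
  rewrite Hh, E1, E2, nth_state_index, HT.
  destruct (nth_error u i); cbn [c_st c_ih c_out mv_in]; rewrite Ho.
  - repeat split. lia.
  - now rewrite app_nil_r.
Qed.

Lemma firstn_succ {A} (u : list A) i a :
  nth_error u i = Some a -> firstn (S i) u = firstn i u ++ [a].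
Proof.
  revert i; induction u as [| b u IH]; intros [| i] H; try discriminate.
  - now injection H as ->.
  - cbn in *. f_equal. now apply IH.
Qed.

Lemma machine_macro_step pre mid w k q h o q' m u :
  q <> Halt -> transition pre mid q (read_in w h) = (q', m, u) ->
  machine_at pre mid w k (state_index q) h o ->
  exists k', machine_at pre mid w k' (state_index q') (mv_in w h m) (o ++ u).
Proof.
  intros Hq HT H0.
  assert (forall i, i <= length u ->
    machine_at pre mid w (k + i) (state_index q + 29 * i) h (o ++ firstn i u)) as HI.
  { induction i as [| i IH]; intros Hi.
    - now rewrite !Nat.add_0_r, app_nil_r.
    - specialize (IH ltac:(lia)). apply (machine_step _ _ _ _ _ _ _ _ _ _ _ Hq HT) in IH.
      destruct (nth_error u i) as [a |] eqn:E;
        [| apply nth_error_None in E; lia].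
      rewrite Nat.add_succ_r, (firstn_succ u i a E), app_assoc. exact IH. }
  specialize (HI _ (le_n _)). rewrite firstn_all in HI.
  apply (machine_step _ _ _ _ _ _ _ _ _ _ _ Hq HT) in HI.
  rewrite (proj2 (nth_error_None u (length u)) (le_n _)) in HI. eauto.
Qed.

Lemma machine_reach pre mid w c c' : reach pre mid w c c' ->
  forall k, (let '(q, h, o) := c in machine_at pre mid w k (state_index q) h o) ->
  exists k', let '(q, h, o) := c' in machine_at pre mid w k' (state_index q) h o.
Proof.
  induction 1 as [c | q h o q' m u c Hq HT _ IH]; intros k Hk; [eauto |].
  destruct (machine_macro_step _ _ _ _ _ _ _ _ _ _ Hq HT Hk) as [k' Hk'].
  apply (IH k' Hk').
Qed.

Lemma machine_computes pre mid (g : list tok -> list tok) :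
  (forall w, exists h, reach pre mid w (Start, 0, []) (Halt, h, g w)) ->
  logspace_computable g.
Proof.
  (* The space constant is 0, as the work head never leaves its first cell. *)
  intros Hg. exists (machine pre mid), 0. split; [apply machine_wf |].
  intros w. destruct (Hg w) as [h Hr].
  destruct (machine_reach _ _ _ _ _ Hr 0) as [n (Hs & _ & Ho)]; [repeat split |].
  exists n. split; [exact Hs |]. split; [exact Ho |].
  intros k _. rewrite machine_work_head. lia.
Qed.

(** * Runs of the transducer *)

(* Head position [S n] is the first letter of [skipn n w]. *)
Lemma skipn_app_next {A} (w : list A) n x u :
  skipn n w = x ++ u -> skipn (n + length x) w = u.
Proof.
  intros H. rewrite Nat.add_comm, <- skipn_skipn, H.
  now rewrite skipn_app, skipn_all, Nat.sub_diag.
Qed.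

Lemma read_in_skipn w n a u : skipn n w = a :: u -> read_in w (S n) = Sym a.
Proof.
  intros H. cbn [read_in]. rewrite <- (Nat.add_0_r n), <- nth_error_skipn, H. reflexivity.
Qed.

Lemma read_in_end w n : skipn n w = [] -> read_in w (S n) = REnd.
Proof.
  intros H. cbn [read_in]. rewrite <- (Nat.add_0_r n), <- nth_error_skipn, H. reflexivity.
Qed.

Lemma move_right w n a u : skipn n w = a :: u -> mv_in w (S n) MRight = S (S n).
Proof.
  intros H. apply (f_equal (@length tok)) in H. rewrite length_skipn in H.
  cbn [mv_in length] in *. lia.
Qed.

Lemma step_right pre mid w n a u q q' x o c :
  skipn n w = a :: u -> q <> Halt -> transition pre mid q (Sym a) = (q', MRight, x) ->
  reach pre mid w (q', S (S n), o ++ x) c -> reach pre mid w (q, S n, o) c.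
Proof.
  intros Hw Hq HT H.
  eapply reach_step; [exact Hq | rewrite (read_in_skipn w n a u Hw); exact HT |].
  now rewrite (move_right w n a u Hw).
Qed.

Lemma run_right pre mid w q (g : tok -> list tok) x n u o :
  skipn n w = x ++ u -> q <> Halt ->
  (forall a, In a x -> transition pre mid q (Sym a) = (q, MRight, g a)) ->
  reach pre mid w (q, S n, o) (q, S (n + length x), o ++ flat_map g x).
Proof.
  intros Hw Hq. revert n o Hw. induction x as [| a x IH]; intros n o Hw Hx.
  - cbn [length flat_map]. rewrite Nat.add_0_r, app_nil_r. apply reach_refl.
  - apply (step_right pre mid w n a (x ++ u) q q (g a)); [exact Hw | exact Hq | apply Hx; now left |].
    cbn [length flat_map]. rewrite Nat.add_succ_r, app_assoc.
    apply (IH (S n)); [| intros b Hb; apply Hx; now right].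
    rewrite <- Nat.add_1_r. now apply (skipn_app_next w n [a]).
Qed.

(** Position [n + length x] is the last letter of the block and [n] the cell to its left, which is
    the end marker when [n] is 0. *)
Lemma run_left pre mid w q (g : tok -> list tok) x n u o :
  skipn n w = x ++ u -> q <> Halt ->
  (forall a, In a x -> transition pre mid q (Sym a) = (q, MLeft, g a)) ->
  reach pre mid w (q, n + length x, o) (q, n, o ++ flat_map g (rev x)).
Proof.
  intros Hw Hq. revert u o Hw. induction x as [| a x IH] using rev_ind; intros u o Hw Hx.
  - cbn [length rev flat_map]. rewrite Nat.add_0_r, app_nil_r. apply reach_refl.
  - rewrite rev_app_distr, length_app, Nat.add_assoc. cbn [rev app flat_map length].
    rewrite <- app_assoc in Hw. rewrite Nat.add_1_r.
    eapply reach_step; [exact Hq | |].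
    { rewrite (read_in_skipn w (n + length x) a u) by now apply skipn_app_next.
      apply Hx, in_elt. }
    replace (mv_in _ _ MLeft) with (n + length x) by (cbn; lia).
    rewrite app_assoc. apply (IH ([a] ++ u)); [exact Hw |].
    intros b Hb. apply Hx, in_or_app. now left.
Qed.

Lemma In_digits ds a : forallb is_digit ds = true -> In a ds -> a = D0 \/ a = D1.
Proof.
  intros H Ha. rewrite forallb_forall in H. specialize (H a Ha). destruct a; auto; discriminate.
Qed.

Lemma flat_map_nil {A B} (l : list A) : flat_map (fun _ => @nil B) l = [].
Proof. now induction l. Qed.

(** The comma before the digits stops the silent return. The rest [u] is general because the lemma
    also serves on malformed words. *)
Lemma run_atom pre mid w n ds u o :
  skipn n w = Comma :: ds ++ u ->
  forallb is_digit ds = true -> match u with a :: _ => is_digit a = false | [] => True end ->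
  reach pre mid w (AtomOpen, S (S n), o)
                  (AtomClose, S (S n + length ds), o ++ enc_aterm (binary_term ds)).
Proof.
  intros Hw Hds Hu. rewrite enc_binary_term.
  assert (skipn (S n) w = ds ++ u) as Hw1
    by (rewrite <- Nat.add_1_r; now apply (skipn_app_next w n [Comma])).
  assert (skipn (S n + length ds) w = u) as Hw2 by now apply skipn_app_next.
  eapply reach_trans; [apply (run_right pre mid w AtomOpen (fun _ => binary_opener) ds _ u) |].
  { exact Hw1. }
  { discriminate. }
  { intros a Ha. now destruct (In_digits ds a Hds Ha) as [-> | ->]. }
  eapply reach_step with (q' := AtomBack) (m := MLeft) (u := enc_aterm AZero); [discriminate | |].
  { destruct u as [| a u].
    - now rewrite read_in_end by exact Hw2.
    - rewrite (read_in_skipn w _ a u Hw2). now destruct a. }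
  replace (mv_in _ _ MLeft) with (S n + length ds) by (cbn; lia).
  eapply reach_trans; [apply (run_left pre mid w AtomBack (fun _ => []) ds (S n) u) |].
  { exact Hw1. }
  { discriminate. }
  { intros a Ha. now destruct (In_digits ds a Hds Ha) as [-> | ->]. }
  rewrite flat_map_nil, app_nil_r.
  eapply (step_right pre mid w n Comma); [exact Hw | discriminate | reflexivity |].
  rewrite app_nil_r, !app_assoc. rewrite <- (app_assoc o).
  apply (run_right pre mid w AtomClose binary_closer ds (S n) u); [exact Hw1 | discriminate |].
  intros a Ha. now destruct (In_digits ds a Hds Ha) as [-> | ->].
Qed.

Definition push_digit (q : state) (d : tok) : state :=
  match q with Index _ b2 b1 b0 => Index b2 b1 b0 (digit_val d =? 1) | _ => q end.

Lemma run_register pre mid w o ds : forall n u b3 b2 b1 b0,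
  skipn n w = ds ++ u -> forallb is_digit ds = true ->
  exists c3 c2 c1 c0,
    fold_left push_digit ds (Index b3 b2 b1 b0) = Index c3 c2 c1 c0 /\
    reach pre mid w (Index b3 b2 b1 b0, S n, o) (Index c3 c2 c1 c0, S (n + length ds), o).
Proof.
  induction ds as [| d ds IH]; intros n u b3 b2 b1 b0 Hw Hds.
  - exists b3, b2, b1, b0. split; [reflexivity |]. cbn [length]. rewrite Nat.add_0_r.
    apply reach_refl.
  - cbn [forallb] in Hds. apply andb_prop in Hds as [Hd Hds].
    destruct (IH (S n) u b2 b1 b0 (digit_val d =? 1)) as (c3 & c2 & c1 & c0 & E & H); auto.
    { rewrite <- Nat.add_1_r. now apply (skipn_app_next w n [d]). }
    exists c3, c2, c1, c0. split; [exact E |].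
    apply (step_right pre mid w n d (ds ++ u) _ (Index b2 b1 b0 (digit_val d =? 1)) []).
    + exact Hw.
    + discriminate.
    + destruct d; try discriminate; reflexivity.
    + rewrite app_nil_r. cbn [length]. rewrite Nat.add_succ_r. exact H.
Qed.

(** The index passes through a shift register of four bits, which loses nothing for indices up to
    nine. *)
Lemma run_index pre mid w n k u o q x :
  skipn n w = node_start k ++ u -> k <= 9 -> index_entry k = (q, x) ->
  reach pre mid w (Main, S n, o) (q, S (n + length (node_start k)), o ++ x).
Proof.
  unfold node_start. cbn [app]. intros Hw Hk HE.
  apply (step_right pre mid w n LPar _ Main (Index false false false false) [] _ _ Hw);
    [discriminate | reflexivity |].
  rewrite app_nil_r, <- app_assoc in *.
  assert (skipn (S n) w = enc_nat k ++ [Comma] ++ u) as Hw1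
    by (rewrite <- Nat.add_1_r; now apply (skipn_app_next w n [LPar])).
  destruct (run_register pre mid w o _ _ _ false false false false Hw1 (enc_nat_digits k))
    as (c3 & c2 & c1 & c0 & E & H).
  eapply reach_trans; [exact H |].
  apply (step_right pre mid w _ Comma u _ q x); [now apply skipn_app_next | discriminate | |].
  - unfold transition.
    replace (bits_val c3 c2 c1 c0) with k; [now rewrite HE |].
    do 10 (destruct k as [| k]; [now injection E as <- <- <- <- |]). lia.
  - cbn [length]. rewrite length_app. cbn [length].
    replace (S (n + S (length (enc_nat k) + 1))) with (S (S (S n + length (enc_nat k)))) by lia.
    apply reach_refl.
Qed.

Lemma node_start1 k a : node k [a] = node_start k ++ a ++ [RPar].
Proof.
  unfold node, node_start. cbn [flat_map app]. rewrite app_nil_r.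
  repeat (rewrite <- !app_assoc; cbn [app]). reflexivity.
Qed.

Lemma node_start2 k a b : node k [a; b] = node_start k ++ a ++ [Comma] ++ b ++ [RPar].
Proof.
  unfold node, node_start. cbn [flat_map app]. rewrite app_nil_r.
  repeat (rewrite <- !app_assoc; cbn [app]). reflexivity.
Qed.

Definition translates pre mid (f : ltl) : Prop := forall w n u o,
  skipn n w = enc_ltl f ++ u ->
  reach pre mid w (Main, S n, o) (Main, S (n + length (enc_ltl f)), o ++ enc_soa (tr f)).

Lemma run_unary pre mid k f w n u o : 1 <= k <= 9 ->
  index_entry k = (Main, enc_frames (unary_frames k)) -> translates pre mid f ->
  skipn n w = node k [enc_ltl f] ++ u ->
  reach pre mid w (Main, S n, o)
    (Main, S (n + length (node k [enc_ltl f])), o ++ enc_soa (fill (unary_frames k) (tr f))).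
Proof.
  intros Hk HE IH Hw. rewrite node_start1, enc_unary in * by exact Hk.
  rewrite <- !app_assoc in Hw.
  eapply reach_trans; [exact (run_index pre mid w n k _ o _ _ Hw (proj2 Hk) HE) |].
  apply skipn_app_next in Hw. eapply reach_trans; [exact (IH w _ _ _ Hw) |].
  apply skipn_app_next in Hw.
  eapply (step_right pre mid w _ RPar u Main Main); [exact Hw | discriminate | reflexivity |].
  rewrite <- !app_assoc, !length_app. cbn [length].
  match goal with |- reach _ _ _ (_, ?a, _) (_, ?b, _) => replace a with b by lia end.
  apply reach_refl.
Qed.

Lemma run_binary pre mid k f g w n u o : 1 <= k <= 9 ->
  index_entry k = (Main, binary_prefix k) -> translates pre mid f -> translates pre mid g ->
  skipn n w = node k [enc_ltl f; enc_ltl g] ++ u ->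
  reach pre mid w (Main, S n, o)
    (Main, S (n + length (node k [enc_ltl f; enc_ltl g])),
     o ++ enc_soa (fill (binary_frames k (tr f)) (tr g))).
Proof.
  intros Hk HE IHf IHg Hw. rewrite node_start2, enc_binary in * by exact Hk.
  rewrite <- !app_assoc in Hw.
  eapply reach_trans; [exact (run_index pre mid w n k _ o _ _ Hw (proj2 Hk) HE) |].
  apply skipn_app_next in Hw. eapply reach_trans; [exact (IHf w _ _ _ Hw) |].
  apply skipn_app_next in Hw.
  eapply (step_right pre mid w _ Comma _ Main Main); [exact Hw | discriminate | reflexivity |].
  apply skipn_app_next in Hw. cbn [length] in Hw. rewrite Nat.add_1_r in Hw.
  eapply reach_trans; [exact (IHg w _ _ _ Hw) |].
  apply skipn_app_next in Hw.
  eapply (step_right pre mid w _ RPar u Main Main); [exact Hw | discriminate | reflexivity |].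
  rewrite <- !app_assoc, !length_app. cbn [length].
  match goal with |- reach _ _ _ (_, ?a, _) (_, ?b, _) => replace a with b by lia end.
  apply reach_refl.
Qed.

Lemma run_ltl pre mid f : translates pre mid f.
Proof.
  induction f; intros w n u o Hw; cbn [enc_ltl tr] in *;
    [| eapply run_unary | eapply run_binary | eapply run_binary | eapply run_unary
     | eapply run_unary | eapply run_unary | eapply run_binary | eapply run_binary
     | eapply run_unary]; try eassumption; try reflexivity; try lia.
  rewrite node_start1, enc_atom_formula in *. rewrite <- !app_assoc in Hw.
  eapply reach_trans; [exact (run_index pre mid w n 0 _ o _ _ Hw (Nat.le_0_l 9) eq_refl) |].
  assert (skipn (S (S n)) w = [Comma] ++ enc_nat p ++ [RPar] ++ u) as Hw'
    by (replace (S (S n)) with (n + length [LPar; D0]) by (cbn; lia);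
        now apply (skipn_app_next w n [LPar; D0])).
  replace (S (n + length (node_start 0))) with (S (S (S (S n)))) by (cbn; lia).
  eapply reach_trans; [apply (run_atom pre mid w _ _ _ _ Hw' (enc_nat_digits p)); reflexivity |].
  apply (skipn_app_next w _ [Comma]) in Hw'. apply skipn_app_next in Hw'.
  eapply (step_right pre mid w _ RPar u AtomClose Main);
    [| discriminate | reflexivity |].
  { etransitivity; [| exact Hw']. f_equal. cbn [length]. lia. }
  rewrite <- !app_assoc, !length_app. cbn [length].
  match goal with |- reach _ _ _ (_, ?a, _) (_, ?b, _) => replace a with b by (cbn; lia) end.
  apply reach_refl.
Qed.

(** * Skipping the Kripke structure *)

Definition skip (d : nat) : state :=
  match d with 0 => Skip0 | 1 => Skip1 | 2 => Skip2 | _ => Skip3 end.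

Fixpoint depth (t : tree) : nat :=
  match t with Leaf _ => 0 | Node _ cs => S (list_max (map depth cs)) end.

(** A leaf needs [1 <= d], since [Skip0] halts on a digit outside all parentheses. *)
Definition skips pre mid (t : tree) : Prop := forall d w n u o,
  skipn n w = enc_tree t ++ u -> depth t + d <= 3 ->
  match t with Leaf _ => 1 <= d | Node _ _ => True end ->
  reach pre mid w (skip d, S n, o) (skip d, S (n + length (enc_tree t)), o).

Lemma run_skip_digits pre mid d w n ds u o :
  skipn n w = ds ++ u -> 1 <= d <= 3 -> forallb is_digit ds = true ->
  reach pre mid w (skip d, S n, o) (skip d, S (n + length ds), o).
Proof.
  intros Hw Hd Hds.
  pose proof (run_right pre mid w (skip d) (fun _ => []) ds n u o Hw) as H.
  rewrite flat_map_nil, app_nil_r in H. apply H.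
  - do 4 (destruct d as [| d]; [discriminate |]). lia.
  - intros a Ha. destruct (In_digits ds a Hds Ha) as [-> | ->];
      do 4 (destruct d as [| d]; [lia || reflexivity |]); lia.
Qed.

Lemma run_skip_forest pre mid cs : Forall (skips pre mid) cs -> forall d w n u o,
  skipn n w = forest cs ++ u -> Forall (fun t => depth t + d <= 3) cs -> 1 <= d <= 3 ->
  reach pre mid w (skip d, S n, o) (skip d, S (n + length (forest cs)), o).
Proof.
  induction 1 as [| t cs Ht _ IH]; intros d w n u o Hw Hd Hd1.
  - cbn. rewrite Nat.add_0_r. apply reach_refl.
  - apply Forall_cons_iff in Hd as [Hdt Hd]. rewrite forest_cons in *.
    cbn [app] in Hw. rewrite <- app_assoc in Hw.
    apply (step_right pre mid w n Comma _ (skip d) (skip d) [] _ _ Hw).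
    { do 4 (destruct d as [| d]; [discriminate |]). lia. }
    { do 4 (destruct d as [| d]; [lia || reflexivity |]). lia. }
    apply (skipn_app_next w n [Comma]) in Hw. cbn [length] in Hw.
    rewrite Nat.add_1_r in Hw. rewrite app_nil_r.
    eapply reach_trans; [apply (Ht d w (S n) _ o Hw Hdt); destruct t; auto; lia |].
    apply skipn_app_next in Hw.
    cbn [length]. rewrite length_app, Nat.add_succ_r, Nat.add_assoc.
    apply (IH d w _ u o Hw Hd Hd1).
Qed.

Lemma run_skip pre mid t : skips pre mid t.
Proof.
  induction t as [m | k cs IH] using tree_ind_forall; intros d w n u o Hw Hd H1.
  - apply (run_skip_digits pre mid d w n _ u o Hw); [| apply enc_nat_digits].
    cbn in Hd. lia.
  - rewrite enc_tree_node in *. cbn [depth] in Hd. cbn [app] in Hw.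
    rewrite <- !app_assoc in Hw.
    apply (step_right pre mid w n LPar _ (skip d) (skip (S d)) [] _ _ Hw).
    { do 4 (destruct d as [| d]; [discriminate |]). lia. }
    { do 3 (destruct d as [| d]; [reflexivity |]). lia. }
    apply (skipn_app_next w n [LPar]) in Hw. cbn [length] in Hw.
    rewrite Nat.add_1_r in Hw. rewrite app_nil_r.
    eapply reach_trans;
      [apply (run_skip_digits pre mid (S d) w _ _ _ _ Hw); [lia | apply enc_nat_digits] |].
    apply skipn_app_next in Hw.
    eapply reach_trans; [apply (run_skip_forest pre mid cs IH (S d) w _ _ _ Hw) |].
    { apply Forall_forall. intros t Ht.
      assert (depth t <= list_max (map depth cs)); [| lia].
      pose proof (proj1 (list_max_le (map depth cs) _) (le_n _)) as F.
      rewrite Forall_forall in F. apply F, in_map, Ht. }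
    { lia. }
    apply skipn_app_next in Hw.
    eapply (step_right pre mid w _ RPar u (skip (S d)) (skip d) []); [exact Hw | | |].
    { do 3 (destruct d as [| d]; [discriminate |]). lia. }
    { do 3 (destruct d as [| d]; [reflexivity |]). lia. }
    rewrite app_nil_r. cbn [length]. rewrite !length_app. cbn [length].
    match goal with |- reach _ _ _ (_, ?a, _) (_, ?b, _) => replace a with b by lia end.
    apply reach_refl.
Qed.

(** The three levels are the structure, its lists, and the single edges or labels; they account for
    the number of skip states. *)
Lemma kripke_tree_depth K : depth (kripke_tree K) <= 3.
Proof.
  assert (forall (A : Type) (g : A -> tree) n l, (forall x, depth (g x) <= n) ->
            list_max (map depth (map g l)) <= n) as HM.
  { intros A g n l H. apply list_max_le, Forall_forall. intros m Hm.
    rewrite map_map in Hm. apply in_map_iff in Hm as (x & <- & _). apply H. }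
  pose proof (HM _ edge_tree 1 (kw_edges K) ltac:(intros; cbn; lia)).
  pose proof (HM _ label_tree 1 (kw_lab K)
    ltac:(intros l; unfold label_tree; cbn [depth];
          pose proof (HM _ Leaf 0 l ltac:(intros; cbn; lia)); lia)).
  unfold kripke_tree. cbn [depth map list_max fold_right]. lia.
Qed.

Lemma run_prefix pre mid w :
  reach pre mid w (Start, 0, [])
    (Head, 1, pre ++ enc_aterm (code_term w AZero) ++ mid).
Proof.
  assert (skipn 0 w = w ++ []) as Hw by (now rewrite app_nil_r).
  eapply reach_step with (q' := TermOpen) (m := MRight) (u := pre);
    [discriminate | reflexivity |].
  change (mv_in w 0 MRight) with 1.
  eapply reach_trans; [apply (run_right pre mid w TermOpen code_opener w 0 [] _ Hw) |].
  { discriminate. }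
  { reflexivity. }
  eapply reach_step with (q' := TermClose) (m := MLeft) (u := enc_aterm AZero); [discriminate | |].
  { now rewrite read_in_end by (apply skipn_app_next in Hw; exact Hw). }
  replace (mv_in _ _ MLeft) with (0 + length w) by (cbn; lia).
  eapply reach_trans;
    [apply (run_left pre mid w TermClose (fun _ => [RPar; RPar]) w 0 [] _ Hw) |].
  { discriminate. }
  { reflexivity. }
  eapply reach_step with (q' := Head) (m := MRight) (u := mid); [discriminate | reflexivity |].
  change (mv_in w 0 MRight) with 1.
  (* The closers are written from right to left, but they are all equal, so the order is
     immaterial. *)
  assert (forall x : list tok, flat_map (fun _ => [RPar; RPar]) (rev x)
            = flat_map (fun _ : tok => [RPar; RPar]) x) as E.
  { assert (forall x : list tok, flat_map (fun _ => [RPar; RPar]) x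
              = repeat RPar (2 * length x)) as E.
    { induction x as [| a x IH]; [reflexivity |]. cbn [flat_map length].
      rewrite IH. now replace (2 * S (length x)) with (S (S (2 * length x))) by lia. }
    intros x. now rewrite !E, length_rev. }
  rewrite E, enc_code_term, <- !app_assoc. apply reach_refl.
Qed.

Lemma run_instance pre mid K f :
  exists h, reach pre mid (enc_instance K f) (Start, 0, [])
    (Halt, h, pre ++ enc_aterm (code_term (enc_instance K f) AZero) ++ mid ++
              enc_soa (tr f) ++ repeat RPar 9).
Proof.
  set (w := enc_instance K f).
  assert (skipn 0 w = [LPar; D0] ++ [Comma] ++ enc_kripke K ++ [Comma] ++ enc_ltl f ++ [RPar])
    as Hw.
  { unfold w, enc_instance. rewrite node_start2. reflexivity. }
  eexists. eapply reach_trans; [apply run_prefix |].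
  eapply reach_trans; [apply (run_right pre mid w Head (fun _ => []) _ 0 _ _ Hw) |].
  { discriminate. }
  { intros a [<- | [<- | []]]; reflexivity. }
  apply skipn_app_next in Hw.
  eapply (step_right pre mid w _ Comma _ Head Skip0 []); [exact Hw | discriminate | reflexivity |].
  apply skipn_app_next in Hw.
  rewrite enc_kripke_tree in Hw.
  eapply reach_trans; [apply (run_skip pre mid _ 0 w _ _ _ Hw) |].
  { pose proof (kripke_tree_depth K). lia. }
  { exact I. }
  apply skipn_app_next in Hw.
  eapply (step_right pre mid w _ Comma _ Skip0 Main []); [exact Hw | discriminate | reflexivity |].
  apply skipn_app_next in Hw.
  eapply reach_trans; [eapply (run_ltl pre mid f w); etransitivity; [| exact Hw]; f_equal; cbn [length]; lia |].
  apply skipn_app_next in Hw.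
  (* The closing parenthesis of the instance node produces the nine parentheses that close the outer
     frames. *)
  eapply (step_right pre mid w _ RPar _ Main Main);
    [etransitivity; [| exact Hw]; f_equal; cbn [length]; lia | discriminate | reflexivity |].
  apply (skipn_app_next w _ [RPar] []) in Hw.
  eapply reach_step with (q' := Halt); [discriminate | |].
  { rewrite read_in_end; [reflexivity |].
    etransitivity; [| exact Hw]. f_equal. cbn [length]. lia. }
  rewrite flat_map_nil, !app_nil_r, <- !app_assoc. apply reach_refl.
Qed.

(** * Termination on arbitrary words *)

Definition forward (q : state) : bool :=
  match q with Start | TermOpen | TermClose | AtomOpen | AtomBack => false | _ => true end.

Lemma forward_transition pre mid q a : forward q = true ->
  exists q' x, transition pre mid q (Sym a) = (q', MRight, x) /\
    (forward q' = true \/ q' = AtomOpen /\ a = Comma).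
Proof.
  intros Hq.
  destruct q as [| | | | | | | | | b3 b2 b1 b0 | | | |]; try discriminate Hq;
    destruct a; cbn -[index_entry bits_val];
    try (eexists _, _; split; [reflexivity | left; reflexivity]).
  remember (bits_val b3 b2 b1 b0) as k.
  destruct (index_entry k) as [q' x] eqn:E. exists q', x.
  split; [reflexivity |].
  do 10 (destruct k as [| k]; [injection E as <- _; auto |]).
  injection E as <- _. auto.
Qed.

Lemma forward_transition_end pre mid q : forward q = true ->
  transition pre mid q REnd = (Halt, MRight, []).
Proof. destruct q; intros; try discriminate; reflexivity. Qed.

Lemma digits_prefix (w : list tok) : exists ds u, w = ds ++ u /\
  forallb is_digit ds = true /\ match u with a :: _ => is_digit a = false | [] => True end.
Proof.
  induction w as [| a w (ds & u & -> & Hds & Hu)].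
  - now exists [], [].
  - destruct (is_digit a) eqn:Ha.
    + exists (a :: ds), u. cbn. now rewrite Ha.
    + now exists [], (a :: ds ++ u).
Qed.

Lemma forward_halts pre mid w : forall m n u q o,
  length u <= m -> skipn n w = u -> forward q = true ->
  exists h x, reach pre mid w (q, S n, o) (Halt, h, o ++ x).
Proof.
  induction m as [m IH] using (well_founded_induction lt_wf); intros n u q o Hm Hw Hq.
  assert (q = Halt \/ q <> Halt) as [-> | HN]
    by (destruct q; auto; right; discriminate).
  { exists (S n), []. rewrite app_nil_r. apply reach_refl. }
  destruct u as [| a u].
  - eexists _, []. eapply reach_step; [exact HN | |apply reach_refl].
    rewrite read_in_end by exact Hw. now apply forward_transition_end.
  - destruct (forward_transition pre mid q a Hq) as (q' & x & HT & Hq').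
    cbn [length] in Hm.
    assert (skipn (S n) w = u) as Hw'
      by (rewrite <- Nat.add_1_r; now apply (skipn_app_next w n [a])).
    enough (exists h y, reach pre mid w (q', S (S n), o ++ x) (Halt, h, (o ++ x) ++ y))
      as (h & y & H).
    { exists h, (x ++ y). rewrite <- app_assoc in H.
      exact (step_right pre mid w n a u q q' x o _ Hw HN HT H). }
    destruct Hq' as [Hq' | [-> ->]].
    + apply (IH (m - 1) ltac:(lia) (S n) u); [lia | exact Hw' | exact Hq'].
    + destruct (digits_prefix u) as (ds & v & E & Hds & Hv).
      rewrite E in Hw.
      pose proof (run_atom pre mid w n ds v (o ++ x) Hw Hds Hv) as HA.
      assert (length v <= m - 1) as Hlen
        by (rewrite E, length_app in Hm; lia).
      destruct (IH (m - 1) ltac:(lia) (S n + length ds) v AtomClose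
                  ((o ++ x) ++ enc_aterm (binary_term ds)) Hlen) as (h & y & H).
      * apply skipn_app_next. now rewrite Hw', E.
      * reflexivity.
      * exists h, (enc_aterm (binary_term ds) ++ y).
        rewrite (app_assoc (o ++ x)). exact (reach_trans _ _ _ _ _ _ HA H).
Qed.

Lemma run_halts pre mid w : exists h x,
  reach pre mid w (Start, 0, [])
    (Halt, h, pre ++ enc_aterm (code_term w AZero) ++ mid ++ x).
Proof.
  destruct (forward_halts pre mid w _ 0 (skipn 0 w) Head
              (pre ++ enc_aterm (code_term w AZero) ++ mid) (le_n _) eq_refl eq_refl)
    as (h & x & H).
  exists h, x. rewrite <- !app_assoc in H. exact (reach_trans _ _ _ _ _ _ (run_prefix pre mid w) H).
Qed.

(** * The reduction *)

(** The padding brings the number of frames to nine, so that the last parenthesis of the input is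
    treated like that of any connective. *)
Definition outer_frames (cf : soa) (w : list tok) : list frame :=
  [HEx1 0; HAnd (SEq (AVar 0) (code_term w AZero)); HEx2 0 3; HEx2 1 1;
   HAnd (instance_formula cf); HEx1 1; HAnd (SEq (AVar 1) AZero)] ++ repeat (HAnd ttrue) 2.

Definition word_prefix : list tok :=
  enc_frame (HEx1 0) ++ LPar :: enc_nat 4 ++ Comma :: LPar :: enc_nat 0 ++
  Comma :: enc_aterm (AVar 0) ++ [Comma].

(** Only the second frame mentions the word; the later ones are computed with the empty word and can
    be hard-wired. *)
Definition word_suffix (cf : soa) : list tok :=
  RPar :: Comma :: enc_frames (skipn 2 (outer_frames cf [])).

Lemma enc_outer_frames cf w :
  enc_frames (outer_frames cf w) =
  word_prefix ++ enc_aterm (code_term w AZero) ++ word_suffix cf.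
Proof.
  unfold word_prefix, word_suffix. change (skipn 2 (outer_frames cf []))
    with (skipn 2 (outer_frames cf w)).
  change (outer_frames cf w) with
    (HEx1 0 :: HAnd (SEq (AVar 0) (code_term w AZero)) :: skipn 2 (outer_frames cf w)) at 1.
  remember (skipn 2 (outer_frames cf w)) as hs. remember (code_term w AZero) as t.
  change (enc_frames (HEx1 0 :: HAnd (SEq (AVar 0) t) :: hs))
    with (enc_frame (HEx1 0) ++ enc_frame (HAnd (SEq (AVar 0) t)) ++ enc_frames hs).
  rewrite <- !app_assoc. f_equal. cbn [enc_frame enc_soa]. unfold node. cbn [flat_map].
  rewrite !app_nil_r. cbn [app]. repeat (rewrite <- !app_assoc; cbn [app]). reflexivity.
Qed.

Lemma enc_outer_formula cf w f :
  enc_soa (fill (outer_frames cf w) f) =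
  word_prefix ++ enc_aterm (code_term w AZero) ++ word_suffix cf ++ enc_soa f ++ repeat RPar 9.
Proof. rewrite enc_soa_fill, enc_outer_frames, <- !app_assoc. reflexivity. Qed.

Definition closed_class_formula (cf : soa) : Prop :=
  forall b1 b2, existsb (fun '(Y, m) => Nat.eqb 6 Y && Nat.eqb 2 m) b2 = true ->
    sclosed b1 b2 cf = true.

Lemma closed_outer_formula cf w f :
  closed_class_formula cf -> closed_soa (fill (outer_frames cf w) (tr f)).
Proof.
  intros Hcf. unfold closed_soa, outer_frames. cbn [app repeat fill fold_right plug sclosed].
  rewrite closed_instance, closed_tr by (auto; reflexivity).
  cbn [aclosed ]. rewrite aclosed_code_term. reflexivity.
Qed.

Definition outer_env1 (w : list tok) : nat -> nat := upd1 (fun _ => 0) 0 (code w 0).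

Definition outer_env2 (SE SX : list nat -> Prop) : env2 :=
  upd2 (upd2 (fun _ _ _ => False) 0 3 SE) 1 1 SX.

Lemma soa_true_outer cf w f :
  soa_true (fill (outer_frames cf w) f) <->
  exists SE SX,
    ssat (outer_env1 w) (outer_env2 SE SX) (instance_formula cf) /\
    ssat (upd1 (outer_env1 w) 1 0) (outer_env2 SE SX) f.
Proof.
  unfold soa_true, outer_frames. remember (instance_formula cf) as g.
  cbn [app repeat fill fold_right plug ssat]. setoid_rewrite aeval_code_term.
  cbn [aeval ttrue ssat upd1 Nat.eqb]. split.
  - intros (v & -> & SE & SX & Hg & k & -> & _ & _ & Hf). now exists SE, SX.
  - intros (SE & SX & Hg & Hf). exists (code w 0). split; [reflexivity |].
    exists SE, SX. split; [exact Hg |]. exists 0. auto.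
Qed.

(** Every ternary relation is an enumeration of traces, by excluded middle, so any witness for
    relation 0 can be read as one. *)
Lemma relation_enumerates SE SX : exists e, enumerates (outer_env2 SE SX) e.
Proof.
  exists (fun n i p => if excluded_middle_informative (SE [n; i; p]) then true else false).
  intros n i p. change (SE [n; i; p] <->
    (if excluded_middle_informative (SE [n; i; p]) then true else false) = true).
  destruct (excluded_middle_informative _); split; auto; discriminate.
Qed.

(** The formula in the hole is arbitrary, because on a malformed word nothing is known about it. *)
Lemma soa_true_outer_instance cf C w f : defines_class cf C ->
  soa_true (fill (outer_frames cf w) f) -> exists K g, w = enc_instance K g.
Proof.
  intros HC H. apply soa_true_outer in H as (SE & SX & H & _).
  destruct (relation_enumerates SE SX) as [e He].
  destruct (proj1 (ssat_instance cf C _ _ e HC He) H) as (K & g & E & _).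
  exists K, g. exact (code_inj _ _ E).
Qed.

(** The translated formula [f] and the formula [g] read in the word are independent here; the
    transducer makes them agree. *)
Lemma soa_true_outer_tr cf C w f : defines_class cf C ->
  (forall t, C t -> ult_periodic t) ->
  soa_true (fill (outer_frames cf w) (tr f)) <->
  exists K g, w = enc_instance K g /\ kripke_wf K /\ tsat (team_inter (teamK K) C) f.
Proof.
  intros HC HP. rewrite soa_true_outer. split.
  - intros (SE & SX & H & Hf).
    destruct (relation_enumerates SE SX) as [e He].
    destruct (proj1 (ssat_instance cf C _ _ e HC He) H) as (K & g & E & HK & HT).
    exists K, g. split; [exact (code_inj _ _ E) |]. split; [exact HK |].
    rewrite (tsat_ext f _ _ HT). exact (proj1 (ssat_tr e f _ _ He) Hf).
  - intros (K & g & -> & HK & Hf). destruct (team_countable K C HP) as (e & X & HT).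
    exists (fun l => match l with [n; i; p] => e n i p = true | _ => False end).
    exists (fun l => match l with [n] => X n | _ => False end).
    match goal with |- ssat _ ?e2 _ /\ _ =>
      assert (enumerates e2 e) as He by (intros n i p; reflexivity) end.
    split.
    + apply (ssat_instance cf C _ _ e HC He). exists K, g. split; [reflexivity |].
      split; [exact HK | exact HT].
    + apply (ssat_tr e f _ _ He). rewrite (tsat_ext f _ _ HT) in Hf. exact Hf.
Qed.

Theorem model_checking_reducible cf C :
  defines_class cf C -> closed_class_formula cf -> (forall t, C t -> ult_periodic t) ->
  logspace_reducible (MC_lang C) Delta20.
Proof.
  intros HC Hcf HP.
  (* The output is fully specified on instances only; elsewhere its initial frames suffice, and the
     function is then obtained by choice. *)
  assert (forall w, exists x,
    (exists h, reach word_prefix (word_suffix cf) w (Start, 0, []) (Halt, h, x)) /\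
    (exists y, x = enc_frames (outer_frames cf w) ++ y) /\
    (forall K f, w = enc_instance K f -> x = enc_soa (fill (outer_frames cf w) (tr f)))) as Hg.
  { intros w. destruct (classic (exists K f, w = enc_instance K f)) as [(K & f & ->) | Hw].
    - destruct (run_instance word_prefix (word_suffix cf) K f) as [h Hr].
      rewrite <- enc_outer_formula in Hr. eexists. split; [exists h; exact Hr |]. split.
      + rewrite enc_soa_fill. eexists. reflexivity.
      + intros K' f' E. now rewrite (enc_instance_inj _ _ _ _ E).
    - destruct (run_halts word_prefix (word_suffix cf) w) as (h & y & Hr).
      eexists. split; [exists h; exact Hr |]. split.
      + exists y. now rewrite enc_outer_frames, <- !app_assoc.
      + intros K f E. destruct Hw. now exists K, f. }
  exists (fun w => proj1_sig (constructive_indefinite_description _ (Hg w))). split.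
  - apply (machine_computes word_prefix (word_suffix cf)). intros w.
    destruct (constructive_indefinite_description _ (Hg w)) as (x & Hx & H'). exact Hx.
  - intros w. destruct (constructive_indefinite_description _ (Hg w)) as (x & Hr & [y Hy] & Hx).
    cbn [proj1_sig]. clear Hr. split.
    + intros (K & f & Ew & HK & Hf). exists (fill (outer_frames cf w) (tr f)).
      split; [exact (Hx K f Ew) |]. split; [now apply closed_outer_formula |].
      apply (soa_true_outer_tr cf C w f HC HP). now exists K, f.
    (* A true output starts with the outer frames, which forces the input to be an instance, and
       only then is the output known exactly. *)
    + intros (g & Eg & _ & Hg'). rewrite Eg in Hy.
      destruct (enc_frames_prefix _ _ _ Hy) as [g' ->].
      destruct (soa_true_outer_instance cf C w g' HC Hg') as (K & f & Ew).
      rewrite (Hx K f Ew) in Eg.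
      rewrite <- (app_nil_r (enc_soa _)), <- (app_nil_r (enc_soa (fill _ g'))) in Eg.
      apply enc_soa_prefix in Eg as [Eg _]. rewrite <- Eg in Hg'.
      apply (soa_true_outer_tr cf C w f HC HP) in Hg' as (K' & f' & Ew' & HK' & Hf').
      exists K', f. rewrite Ew in Ew'. pose proof (enc_instance_inj _ _ _ _ Ew') as <-.
      rewrite Ew. auto.
Qed.

(** * The two classes of traces *)

Definition periodic_formula : soa :=
  SEx1 50 (SEx1 51 (SAnd (Lt AZero (AVar 50)) (SAnd (Lt AZero (AVar 51))
    (SAll1 52 (SAll1 53 (Imp (SLe (AVar 50) (AVar 52))
      (Iff (SApp 6 [AVar 52; AVar 53]) (SApp 6 [APlus (AVar 52) (AVar 51); AVar 53])))))))).

Definition constant_formula : soa :=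
  SEx1 50 (SAll1 52 (SAll1 53
    (Iff (SApp 6 [APlus (AVar 50) (AVar 52); AVar 53]) (SApp 6 [AVar 50; AVar 53])))).

Lemma periodic_formula_defines : defines_class periodic_formula ult_periodic.
Proof.
  intros e1 e2 t Ht. unfold periodic_formula, ult_periodic. cbn [ssat].
  setoid_rewrite ssat_Imp. setoid_rewrite ssat_Iff. cbn. setoid_rewrite Ht.
  unfold lt. split.
  - intros (c & d & Hc & Hd & H). exists c, d. repeat split; auto.
    intros n p Hn. apply eq_true_iff_eq. auto.
  - intros (c & d & Hc & Hd & H). exists c, d. repeat split; auto;
      rewrite (H _ _ H0); auto.
Qed.

Lemma constant_formula_defines : defines_class constant_formula ult_constant.
Proof.
  intros e1 e2 t Ht. unfold constant_formula, ult_constant. cbn [ssat].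
  setoid_rewrite ssat_Iff. cbn. setoid_rewrite Ht.
  split; intros [i H]; exists i; intros n p; [apply eq_true_iff_eq, H | now rewrite H].
Qed.

Lemma ult_constant_periodic t : ult_constant t -> ult_periodic t.
Proof.
  (* The successor makes the threshold positive. *)
  intros [i H]. exists (S i), 1. split; [lia |]. split; [lia |]. intros n p Hn.
  pose proof (H (n - i) p) as H1. pose proof (H (n + 1 - i) p) as H2.
  replace (i + (n - i)) with n in H1 by lia.
  replace (i + (n + 1 - i)) with (n + 1) in H2 by lia. congruence.
Qed.

Theorem mainTheorem13 :
  logspace_reducible (MC_lang ult_periodic) Delta20 /\
  logspace_reducible (MC_lang ult_constant) Delta20.
Proof.
  split.
  - apply (model_checking_reducible periodic_formula);
      [exact periodic_formula_defines | | auto].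
    intros b1 b2 H. cbn in *. now rewrite H.
  - apply (model_checking_reducible constant_formula);
      [exact constant_formula_defines | | exact ult_constant_periodic].
    intros b1 b2 H. cbn in *. now rewrite H.
Qed.
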